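(* The All-the-Same-SAT problem restricted to 3-CNF$_{\leq 4}$ formulae is NP-complete.
   Context: A 3-CNF formula is a conjunction of clauses, each clause being a disjunction of exactly three literal occurrences (a literal is a propositional variable $v$ or its negation $\lnot v$; the same literal may occur more than once in a clause, e.g. $x\vee x\vee\lnot x$). A 3-CNF$_{\leq 4}$ formula is a 3-CNF formula in which each variable occurs at most $4$ times. The All-the-Same-SAT problem: given a 3-CNF formula, decide whether there is a truth assignment (valuation) of its variables under which every clause has exactly the same number of true literal occurrences (this common number may be $0$, so the valuation need not satisfy the formula). *)

(* Defs.v *)
From Stdlib Require Import BinNums BinPos.
From mathcomp Require Import all_boot.
Set Implicit Arguments. Unset Strict Implicit. Unset Printing Implicit Defensive.

(* A literal is (s, v): the variable v (a natural number) if s = true,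
   its negation if s = false.  A clause consists of exactly three literal
   occurrences (repetitions allowed).  A 3-CNF formula is a list of clauses. *)
Definition literal := (bool * nat)%type.
Definition clause := (literal * literal * literal)%type.
Definition formula := seq clause.

Definition clause_lits (c : clause) : seq literal :=
  let: (a, b, d) := c in [:: a; b; d].

Definition occurrences (F : formula) (v : nat) : nat :=
  count (fun l : literal => l.2 == v) (flatten (map clause_lits F)).

Definition is_3cnf_le4 (F : formula) : Prop := forall v, occurrences F v <= 4.

Definition lit_val (val : nat -> bool) (l : literal) : bool := val l.2 == l.1.

Definition ntrue (val : nat -> bool) (c : clause) : nat :=
  count (lit_val val) (clause_lits c).

Definition all_the_same_sat (F : formula) : Prop :=
  exists (val : nat -> bool) (k : nat), all (fun c => ntrue val c == k) F.

Fixpoint pos_bits (p : positive) : seq bool :=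
  match p with
  | xI q => true :: pos_bits q
  | xO q => false :: pos_bits q
  | xH => [::]
  end.

(* binary representation of n (of n+1 without its leading 1, LSB first) *)
Definition nat_bits (n : nat) : seq bool := pos_bits (Pos.of_succ_nat n).

(* self-delimiting code: data bit b |-> [true; b], end marker [false; false] *)
Definition data_bits (s : seq bool) : seq bool :=
  flatten (map (fun b => [:: true; b]) s).

Definition enc_lit (l : literal) : seq bool :=
  [:: true; l.1] ++ data_bits (nat_bits l.2) ++ [:: false; false].

Definition enc_formula (F : formula) : seq bool :=
  flatten (map (fun c => flatten (map enc_lit (clause_lits c))) F).

Definition ATS_3CNF4 (w : seq bool) : Prop :=
  exists F : formula, w = enc_formula F /\ is_3cnf_le4 F /\ all_the_same_sat F.

Inductive move := MvL | MvR | MvS.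

(* States: 'I_(tm_Q.+1); tape symbols: 'I_(tm_S.+3), where symbol 0 is the
   blank, 1 encodes the bit false and 2 the bit true. *)
Record TM := {
  tm_Q : nat;
  tm_S : nat;
  tm_start : 'I_tm_Q.+1;
  tm_acc : 'I_tm_Q.+1;
  tm_rej : 'I_tm_Q.+1;
  tm_delta : 'I_tm_Q.+1 -> 'I_tm_S.+3 -> ('I_tm_Q.+1 * 'I_tm_S.+3 * move)
}.

Definition state (M : TM) := 'I_(tm_Q M).+1.
Definition sym (M : TM) := 'I_(tm_S M).+3.

(* configuration: state, (left part reversed, scanned symbol, right part) *)
Definition config (M : TM) := (state M * (seq (sym M) * sym M * seq (sym M)))%type.

Definition blank (M : TM) : sym M := ord0.
Definition sym_of_bool (M : TM) (b : bool) : sym M := if b then inord 2 else inord 1.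

Definition halted (M : TM) (c : config M) : bool :=
  (c.1 == tm_acc M) || (c.1 == tm_rej M).

Definition step (M : TM) (c : config M) : config M :=
  if halted c then c else
  let: (q, (l, a, r)) := c in
  let: (q', b, m) := tm_delta q a in
  match m with
  | MvS => (q', (l, b, r))
  | MvR => match r with
           | [::] => (q', (b :: l, @blank M, [::]))
           | x :: r' => (q', (b :: l, x, r'))
           end
  | MvL => match l with
           | [::] => (q', ([::], b, r))
           | x :: l' => (q', (l', x, b :: r))
           end
  end.

Definition run (M : TM) (n : nat) (c : config M) : config M := iter n (@step M) c.

Definition init (M : TM) (w : seq bool) : config M :=
  match map (@sym_of_bool M) w with
  | [::] => (tm_start M, ([::], @blank M, [::]))
  | x :: r => (tm_start M, ([::], x, r))
  end.

Definition bit_of_sym (M : TM) (s : sym M) : option bool :=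
  if val s == 1 then Some false else if val s == 2 then Some true else None.

Fixpoint read_bits (M : TM) (s : seq (sym M)) : seq bool :=
  match s with
  | [::] => [::]
  | x :: s' => match bit_of_sym x with
               | Some b => b :: read_bits s'
               | None => [::]
               end
  end.

Definition output (M : TM) (c : config M) : seq bool :=
  let: (_, (_, a, r)) := c in read_bits (a :: r).

Definition poly_bound (k n : nat) : nat := k * n ^ k + k.

Definition language := seq bool -> Prop.

Definition decides_in_poly_time (M : TM) (L : language) : Prop :=
  exists k, forall w, let c := @run M (poly_bound k (size w)) (@init M w) in
    halted c /\ ((c.1 == tm_acc M) <-> L w).

Definition in_P (L : language) : Prop := exists M, decides_in_poly_time M L.

Definition computes_in_poly_time (M : TM) (f : seq bool -> seq bool) : Prop :=
  exists k, forall w, let c := @run M (poly_bound k (size w)) (@init M w) in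
    halted c /\ output c = f w.

Definition in_FP (f : seq bool -> seq bool) : Prop := exists M, computes_in_poly_time M f.

Definition pair_enc (w y : seq bool) : seq bool := data_bits w ++ [:: false; false] ++ y.

Definition in_NP (L : language) : Prop :=
  exists V : language, in_P V /\ exists k, forall w,
    L w <-> exists y : seq bool, size y <= poly_bound k (size w) /\ V (pair_enc w y).

Definition poly_reduces (L1 L2 : language) : Prop :=
  exists f, in_FP f /\ forall w, L1 w <-> L2 (f w).

Definition NP_hard (L : language) : Prop := forall L', in_NP L' -> poly_reduces L' L.

Definition NP_complete (L : language) : Prop := in_NP L /\ NP_hard L.

(* Main.v *)
Require Import Defs.
From Stdlib Require Import BinNums BinPos FunctionalExtensionality.
From mathcomp Require Import all_boot zify.
Set Implicit Arguments. Unset Strict Implicit. Unset Printing Implicit Defensive.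

(** Membership: the witness lists the names of the true variables.  The verifier
    parses the word carelessly, and re-encodes the result to see whether it was
    well formed.

    Hardness: a computation tableau with variables "column [i] shows [g] at time
    [t]" is described by Horn clauses, apart from the guessed input cells.  No
    uniqueness clauses are needed: the true variables contain those of an actual
    run, and clauses excluding rejecting states at the last time do the rest.
    Schaefer's gadget turns 3-SAT into one-in-three satisfiability.  A clause
    [f, f, ~f] has [1 + f] true literals, so the common number is 1 or 2, and
    complementing the valuation if necessary makes it 1; then [f] is false, and a
    clause [v, ~v', f] says [v = v'].  Every occurrence of a variable can thus use
    its own copy, linked to the next, and each variable occurs at most 4 times.
    Since [nat_bits] is onto, variables may be named by arbitrary bit strings.

    Polynomial time: a class of functions on data encoded by binary trees is
    closed under composition, pairing and size-bounded iteration over lists.  A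
    tree is written in prefix notation on a stack, programs over four stacks are
    compiled to flat code, and that code is run by a one-tape machine whose cells
    carry one bit of each stack, the bottoms being aligned at the left end. *)

(** * Turing machines on functional tapes *)

(** The common numbers 0 and 3 have to be excluded by clauses, since complementation only repairs 2.
    A single false variable shared by all links would occur too often, so each link has its own;
    this variable, and no copy, is what attains the bound 4. The classes P and FP refer to one
    concrete machine model, so every function in the verifier and in the reduction needs an actual
    program. Prefix notation is self-delimiting: a value can lie on top of others, and a program can
    work on it without disturbing what is below. Composition needs polynomial output sizes, which
    the running time provides. Iteration does not preserve polynomial time, as a step that doubles
    its argument shows, and therefore comes with a size bound. Unary numbers suffice, because times,
    columns and positions are all polynomially bounded. *)

Section TapeMachine.

Variables (Q A : Type) (halts : pred Q) (delta : Q -> A -> Q * A * move).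

Definition tconf := (Q * nat * (nat -> A))%type.

Definition write (t : nat -> A) (h : nat) (b : A) : nat -> A :=
  fun j => if j == h then b else t j.

Definition shift (m : move) (h : nat) : nat :=
  match m with MvL => h.-1 | MvR => h.+1 | MvS => h end.

Definition tstep (c : tconf) : tconf :=
  let: (q, h, t) := c in
  if halts q then c else
  let: (q', b, m) := delta q (t h) in (q', shift m h, write t h b).

Lemma write_same t h : write t h (t h) = t.
Proof. by apply: functional_extensionality => j; rewrite /write; case: eqP => [->|]. Qed.

Lemma iter_tstep_halted n c : halts c.1.1 -> iter n tstep c = c.
Proof.
move=> hc; elim: n => //= n ->.
by case: c hc => [[q h] t] /= hq; rewrite /tstep hq.
Qed.

End TapeMachine.

Arguments tstep : simpl never.

Section FunctionTape.

Variable M : TM.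

Definition tm_halts : pred (state M) := fun q => (q == tm_acc M) || (q == tm_rej M).

Definition tm_tstep : tconf (state M) (sym M) -> tconf (state M) (sym M) :=
  tstep tm_halts (@tm_delta M).

Definition represents (c : config M) (f : tconf (state M) (sym M)) : Prop :=
  let: (q, (l, a, r)) := c in
  [/\ f.1.1 = q, f.1.2 = size l
    & forall i, nth (@blank M) (rev l ++ a :: r) i = f.2 i].

(** Both boundary cases of [step] vanish on a functional tape: the truncated predecessor keeps the
    head on cell 0, and a cell beyond the list already reads blank. *)
Lemma represents_step c f : represents c f -> represents (step c) (tm_tstep f).
Proof.
case: c => q [[l a] r]; case: f => [[q' h] t] /= [-> -> ht].
rewrite /step /halted /tm_tstep /tstep /tm_halts /=.
case: ifP => // _.
have -> : t (size l) = a by rewrite -ht nth_cat size_rev ltnn subnn.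
case: (tm_delta q a) => [[q1 b] m].
have hw i : nth (@blank M) (rev l ++ b :: r) i = write t (size l) b i.
  rewrite /write -ht !nth_cat size_rev.
  case: (ltngtP i (size l)) => [//||->]; last by rewrite subnn.
  by case: (i - size l) (subn_gt0 (size l) i) => [|j] // <-.
case: m => /=.
- case: l ht hw => [|x l] ht hw /=; split=> // i; rewrite -hw // rev_cons cat_rcons //.
- case: r ht hw => [|x r] ht hw /=; split=> // i; rewrite -hw rev_cons cat_rcons //.
  rewrite !nth_cat size_rev; case: ltnP => // _.
  by case: (i - size l) => [|[|[]]].
- by split.
Qed.

Lemma represents_run n c f :
  represents c f -> represents (run n c) (iter n tm_tstep f).
Proof. by move=> hc; elim: n => //= n; apply: represents_step. Qed.

Definition tm_tinit (w : seq bool) : tconf (state M) (sym M) :=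
  (tm_start M, 0, fun i => nth (@blank M) (map (@sym_of_bool M) w) i).

Lemma represents_init w : represents (init M w) (tm_tinit w).
Proof.
rewrite /init /tm_tinit; case: (map _ w) => [|x r] /=; split=> // i.
by rewrite nth_seq1 nth_nil if_same.
Qed.

Lemma bit_of_symK b : bit_of_sym (sym_of_bool M b) = Some b.
Proof. by case: b; rewrite /bit_of_sym /sym_of_bool /= inordK. Qed.

(** At [j = size u] the hypothesis supplies a blank, which is what stops [read_bits]. *)
Lemma represents_output c f u :
    represents c f ->
    (forall j, j <= size u -> f.2 (f.1.2 + j) = nth (@blank M) (map (@sym_of_bool M) u) j) ->
  output c = u.
Proof.
case: c => q [[l a] r]; case: f => [[q' h] t] [/= _ -> ht] hu.
rewrite -[LHS]/(read_bits (a :: r)).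
have: forall j, j <= size u ->
    nth (@blank M) (a :: r) j = nth (@blank M) (map (@sym_of_bool M) u) j.
  move=> j hj; rewrite -hu // -ht nth_cat size_rev ltnNge leq_addr /=.
  by rewrite addKn.
move: (a :: r) => s; elim: s u {ht hu} => [|x s IH] [|b u] hs //=.
- by have := congr1 (@bit_of_sym M) (hs 0 isT); rewrite [RHS]bit_of_symK.
- by have:= hs 0 isT => /= ->.
- have := hs 0 isT => /= ->; rewrite bit_of_symK; congr (_ :: _).
  by apply: IH => j hj; apply: (hs j.+1).
Qed.

End FunctionTape.

(** * Machines over arbitrary finite types of states and symbols *)

Section AbstractMachine.

Variables (St Cell : finType).
Let Sym := (option bool + Cell)%type.
Variable delta : St -> Sym -> St * Sym * move.
Variables start acc rej : St.

(** The order matters: positions 0, 1 and 2 are those that [TM] reserves for blank, false and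
    true. *)
Definition symbols : seq Sym :=
  [:: inl None; inl (Some false); inl (Some true)] ++ map inr (enum Cell).

Lemma mem_symbols x : x \in symbols.
Proof.
case: x => [[[]|]|c] //=; rewrite !inE /=.
by apply/mapP; exists c; rewrite ?mem_enum.
Qed.

Definition enc_state (q : St) : 'I_(#|St|).+1 := inord (index q (enum St)).
Definition dec_state (i : 'I_(#|St|).+1) : St := nth start (enum St) i.
Definition enc_sym (x : Sym) : 'I_(#|Cell|).+3 := inord (index x symbols).
Definition dec_sym (i : 'I_(#|Cell|).+3) : Sym := nth (inl None) symbols i.

Lemma enc_stateK : cancel enc_state dec_state.
Proof.
move=> q; rewrite /dec_state /enc_state inordK ?nth_index ?mem_enum //.
by rewrite ltnS cardE index_size.
Qed.

Lemma enc_symK : cancel enc_sym dec_sym.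
Proof.
have hs : size symbols = (#|Cell|).+3 by rewrite /= size_map -cardE.
move=> x; rewrite /dec_sym /enc_sym inordK ?nth_index ?mem_symbols //.
by rewrite -hs index_mem mem_symbols.
Qed.

Definition machine : TM := {|
  tm_Q := #|St|; tm_S := #|Cell|;
  tm_start := enc_state start; tm_acc := enc_state acc; tm_rej := enc_state rej;
  tm_delta := fun q x => let: (q', b, m) := delta (dec_state q) (dec_sym x) in
                         (enc_state q', enc_sym b, m) |}.

Definition a_halts : pred St := fun q => (q == acc) || (q == rej).

Definition embed (c : tconf St Sym) : tconf (state machine) (sym machine) :=
  let: (q, h, t) := c in (enc_state q, h, fun j => enc_sym (t j)).

Lemma tm_halts_embed q : @tm_halts machine (enc_state q) = a_halts q.
Proof. by rewrite /tm_halts /a_halts /= !(can_eq enc_stateK). Qed.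

Lemma embed_step c : @tm_tstep machine (embed c) = embed (tstep a_halts delta c).
Proof.
case: c => [[q h] t] /=; rewrite /tm_tstep /tstep tm_halts_embed.
case: ifP => // _; rewrite /= enc_stateK enc_symK.
case: (delta q (t h)) => [[q' b] m] /=; congr (_, _).
by apply: functional_extensionality => j; rewrite /write; case: eqP.
Qed.

Lemma embed_run n c :
  iter n (@tm_tstep machine) (embed c) = embed (iter n (tstep a_halts delta) c).
Proof. by elim: n => //= n ->; apply: embed_step. Qed.

Lemma enc_sym_bool b : sym_of_bool machine b = enc_sym (inl (Some b)).
Proof. by case: b. Qed.

Lemma enc_sym_bits w j :
  nth (@blank machine) (map (@sym_of_bool machine) w) j = enc_sym (inl (onth w j)).
Proof.
elim: w j => [|b w IH] [|j] //=; try by rewrite enc_sym_bool.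
- by apply: val_inj; rewrite /= inordK.
- by apply: val_inj; rewrite /= inordK.
Qed.

Definition a_init (w : seq bool) : tconf St Sym := (start, 0, fun j => inl (onth w j)).

Lemma embed_init w : @tm_tinit machine w = embed (a_init w).
Proof.
by congr (_, _); apply: functional_extensionality => j; rewrite enc_sym_bits.
Qed.

Lemma represents_machine_run n w :
  represents (run n (init machine w)) (embed (iter n (tstep a_halts delta) (a_init w))).
Proof. by rewrite -embed_run -embed_init; apply/represents_run/represents_init. Qed.

Lemma machine_state n w :
  (run n (init machine w)).1 = enc_state (iter n (tstep a_halts delta) (a_init w)).1.1.
Proof.
have := represents_machine_run n w.
case: (run _ _) => q [[l a] r]; case: (iter _ _ _) => [[q' h] t].
by case=> /= ->.
Qed.

Lemma machine_halted n w :
  halted (run n (init machine w)) = a_halts (iter n (tstep a_halts delta) (a_init w)).1.1.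
Proof. by rewrite /halted machine_state -tm_halts_embed. Qed.

Lemma machine_output n w u :
    (let c := iter n (tstep a_halts delta) (a_init w) in
     forall j, j <= size u -> c.2 (c.1.2 + j) = inl (onth u j)) ->
  output (run n (init machine w)) = u.
Proof.
move=> /= hu; apply: represents_output (represents_machine_run n w) _ => j hj.
move: hu; case: (iter _ _ _) => [[q h] t] /= hu.
by rewrite hu // enc_sym_bits.
Qed.

End AbstractMachine.

(** * Four-stack machines *)

Definition idx := (bool * bool)%type.
Definition quad (T : Type) := (T * T * T * T)%type.

Definition get T (i : idx) (s : quad T) : T :=
  let: (a, b, c, d) := s in
  match i with
  | (false, false) => a | (false, true) => b
  | (true, false) => c | (true, true) => d
  end.

Definition set T (i : idx) (x : T) (s : quad T) : quad T :=
  let: (a, b, c, d) := s in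
  match i with
  | (false, false) => (x, b, c, d) | (false, true) => (a, x, c, d)
  | (true, false) => (a, b, x, d) | (true, true) => (a, b, c, x)
  end.

Lemma get_set T i j (x : T) s : get i (set j x s) = if i == j then x else get i s.
Proof. by case: s => [[[a b] c] d]; case: i j => [[] []] [[] []]. Qed.

Lemma set_set T i (x y : T) s : set i x (set i y s) = set i x s.
Proof. by case: s => [[[a b] c] d]; case: i => [[] []]. Qed.

Definition stacks := quad (seq bool).

Definition height (s : stacks) : nat :=
  let: (a, b, c, d) := s in size a + size b + size c + size d.

Lemma size_get_height i s : size (get i s) <= height s.
Proof. by case: s => [[[a b] c] d]; case: i => [[] []] /=; lia. Qed.

Lemma height_set i x s : height (set i x s) + size (get i s) = height s + size x.
Proof. by case: s => [[[a b] c] d]; case: i => [[] []] /=; lia. Qed.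

(* The numbers are the addresses at which execution continues. *)
Inductive instr :=
  | IPush of idx & bool & nat
  | IPop of idx & nat & nat & nat
  | INop of nat
  | IHalt of bool
  | IOut.

Definition control (I : instr) : bool :=
  match I with IHalt _ | IOut => false | _ => true end.

Section StackMachine.

Variable P : seq instr.

Let pc_t := 'I_(size P).+1.

Definition fetch (pc : pc_t) : instr := nth (IHalt false) P pc.

Definition istep (c : pc_t * stacks) : pc_t * stacks :=
  let: (pc, s) := c in
  match fetch pc with
  | IPush i b n => (inord n, set i (b :: get i s) s)
  | IPop i e f t =>
      match get i s with
      | [::] => (inord e, s)
      | b :: r => (inord (if b then t else f), set i r s)
      end
  | INop n => (inord n, s)
  | _ => c
  end.

Lemma height_istep c : height (istep c).2 <= (height c.2).+1.
Proof.
case: c => pc s /=; case: (fetch pc) => [i b n|i e f t|n|b|] //=.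
  by have := height_set i (b :: get i s) s; rewrite /=; lia.
case E: (get i s) => [|b r] //=.
by have := height_set i r s; rewrite E /=; lia.
Qed.

(* A tape cell holds a mark, set exactly on cell 0, and one optional bit per
   stack; the bottom of every stack lies in cell 0. *)
Definition cell := (bool * quad (option bool))%type.
Definition ssym := (option bool + cell)%type.

(** A plain symbol counts as a cell where only the first stack has a bit, so the input needs no
    conversion; only cell 0 must be marked. *)
Definition cell_of (x : ssym) : cell :=
  match x with inl r => (false, (r, None, None, None)) | inr c => c end.

(** For stack access, [SGo] scans right to the first free cell of the stack, [SBack] removes the bit
    to the left of it, and [SRet] returns to the marked cell 0. [SOut] walks left and turns cells
    into plain symbols. *)
Definition sstate := (unit + bool + (pc_t * option bool + unit))%type.
Notation SStart := (inl (inl tt) : sstate).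
Notation SHalt b := (inl (inr b) : sstate).
Notation SGo pc := (inr (inl (pc, None)) : sstate).
Notation SBack pc := (inr (inl (pc, Some false)) : sstate).
Notation SRet pc := (inr (inl (pc, Some true)) : sstate).
Notation SOut := (inr (inr tt) : sstate).

(** A stack is empty exactly when its first free cell carries the mark. *)
Definition sdelta (q : sstate) (x : ssym) : sstate * ssym * move :=
  let c := cell_of x in
  match q with
  | inl (inl _) => (SGo ord0, inr (true, c.2), MvS)
  | inl (inr b) => (q, x, MvS)
  | inr (inl (pc, None)) =>
      match fetch pc with
      | IPush i b n =>
          if get i c.2 is None then (SRet (inord n), inr (c.1, set i (Some b) c.2), MvS)
          else (q, x, MvR)
      | IPop i e _ _ =>
          if get i c.2 is None then
            if c.1 then (SGo (inord e), x, MvS) else (SBack pc, x, MvL)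
          else (q, x, MvR)
      | INop n => (SGo (inord n), x, MvS)
      | IHalt b => (SHalt b, x, MvS)
      | IOut =>
          if get (false, false) c.2 is None then
            if c.1 then (SHalt true, inl None, MvS) else (SOut, inl None, MvL)
          else (q, x, MvR)
      end
  | inr (inl (pc, Some false)) =>
      match fetch pc with
      | IPop i _ f t =>
          if get i c.2 is Some b
          then (SRet (inord (if b then t else f)), inr (c.1, set i None c.2), MvS)
          else (q, x, MvS)
      | _ => (q, x, MvS)
      end
  | inr (inl (pc, Some true)) =>
      if c.1 then (SGo pc, x, MvS) else (SRet pc, x, MvL)
  | inr (inr _) =>
      (if c.1 then SHalt true else SOut, inl (get (false, false) c.2), MvL)
  end.

Definition smachine : TM := machine sdelta SStart (SHalt true) (SHalt false).

Let shalts := a_halts (SHalt true) (SHalt false).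
Let ststep := tstep shalts sdelta.

Definition on_tape (s : stacks) (t : nat -> ssym) : Prop :=
  forall j, (cell_of (t j)).1 = (j == 0) /\
            forall i, get i (cell_of (t j)).2 = onth (rev (get i s)) j.

Lemma onth_rcons T (s : seq T) x j :
  onth (rcons s x) j = if j == size s then Some x else onth s j.
Proof. by elim: s j => [|y s IH] [|j] //=; case: j. Qed.

Lemma onth_lt T (s : seq T) j : j < size s -> exists x, onth s j = Some x.
Proof. by elim: s j => // x s IH [|j] //= hj; [exists x | apply: IH]. Qed.

Lemma on_tape_below s t i j :
  on_tape s t -> j < size (get i s) -> exists b, get i (cell_of (t j)).2 = Some b.
Proof. by move=> /(_ j)[_ /(_ i) ->] hj; apply: onth_lt; rewrite size_rev. Qed.

Lemma on_tape_top s t i : on_tape s t -> get i (cell_of (t (size (get i s)))).2 = None.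
Proof. by move=> /(_ (size (get i s)))[_ ->]; rewrite onth_default ?size_rev. Qed.

Lemma ststepE q h t q' b m :
    ~~ shalts q -> sdelta q (t h) = (q', b, m) ->
  ststep (q, h, t) = (q', shift m h, write t h b).
Proof. by rewrite /ststep /tstep => /negbTE -> ->. Qed.

Lemma ststepE_id q h t q' m :
    ~~ shalts q -> sdelta q (t h) = (q', t h, m) ->
  ststep (q, h, t) = (q', shift m h, t).
Proof. by move=> hq hd; rewrite (ststepE hq hd) write_same. Qed.

Lemma scan_right s t pc i :
    on_tape s t ->
    (forall x, (exists b, get i (cell_of x).2 = Some b) ->
               sdelta (SGo pc) x = (SGo pc, x, MvR)) ->
  iter (size (get i s)) ststep (SGo pc, 0, t) = (SGo pc, size (get i s), t).
Proof.
move=> hs hd; elim: {-2}(size _) (leqnn (size (get i s))) => // j IH hj.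
by rewrite iterS IH ?(ltnW hj) // (@ststepE_id _ _ _ (SGo pc) MvR) ?hd //; apply: on_tape_below hs _.
Qed.

Lemma return_left t pc h :
    (forall j, (cell_of (t j)).1 = (j == 0)) ->
  iter h.+1 ststep (SRet pc, h, t) = (SGo pc, 0, t).
Proof.
move=> ht; elim: h => [|h IH].
  by rewrite /= (@ststepE_id _ _ _ (SGo pc) MvS) // /sdelta ht.
by rewrite iterSr (@ststepE_id _ _ _ (SRet pc) MvL) // /sdelta ht.
Qed.

Lemma on_tape_push s t i b :
    let h := size (get i s) in let c := cell_of (t h) in
    on_tape s t ->
  on_tape (set i (b :: get i s) s) (write t h (inr (c.1, set i (Some b) c.2))).
Proof.
move=> h c hs j; have [hm hg] := hs j.
rewrite /write; case: eqP => [ej|/eqP nj]; last first.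
  split=> // i'; rewrite get_set hg; case: eqP => // ->.
  by rewrite rev_cons onth_rcons size_rev (negbTE nj).
rewrite /c -ej; split=> //= i'; rewrite !get_set hg; case: eqP => // _.
by rewrite rev_cons onth_rcons size_rev ej eqxx.
Qed.

Lemma on_tape_pop s t i b r :
    let c := cell_of (t (size r)) in
    on_tape s t -> get i s = b :: r ->
  on_tape (set i r s) (write t (size r) (inr (c.1, set i None c.2))).
Proof.
move=> c hs hi j; have [hm hg] := hs j.
rewrite /write; case: eqP => [ej|/eqP nj]; last first.
  split=> // i'; rewrite get_set hg; case: eqP => // ->.
  by rewrite hi rev_cons onth_rcons size_rev (negbTE nj).
rewrite /c -ej; split=> //= i'; rewrite !get_set hg; case: eqP => // _.
by rewrite onth_default ?size_rev ?ej.
Qed.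

(** The scan to the free cell and the return to cell 0 each take about as many steps as the stack
    has bits; hence the factor 2. *)
Lemma stack_sim1 pc s t : control (fetch pc) -> on_tape s t ->
  exists n t', [/\ n <= 2 * height s + 4,
    iter n ststep (SGo pc, 0, t) = (SGo (istep (pc, s)).1, 0, t')
    & on_tape (istep (pc, s)).2 t'].
Proof.
move=> + hs; case E: (fetch pc) => [i b n|i e f u|n|b|] //= _; rewrite E /=.
- pose h := size (get i s); have hh := size_get_height i s.
  have hsc : iter h ststep (SGo pc, 0, t) = (SGo pc, h, t).
    by apply: scan_right hs _ => x [b' hb]; rewrite /= E hb.
  have hs' := on_tape_push i b hs.
  set x := inr _ in hs'; set t' := write _ _ _ in hs'.
  exists (h.+1 + (1 + h)), t'; split=> //; first by rewrite -/h in hh; lia.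
  rewrite !iterD hsc /= (@ststepE _ _ _ (SRet (inord n)) x MvS) //=; last first.
    by rewrite E (on_tape_top i hs).
  by rewrite -/t' -iterS return_left // => j; case: (hs' j).
- pose h := size (get i s); have hh := size_get_height i s.
  have hsc : iter h ststep (SGo pc, 0, t) = (SGo pc, h, t).
    by apply: scan_right hs _ => x [b' hb]; rewrite /= E hb.
  have htop := on_tape_top i hs.
  case Ei: (get i s) => [|b r].
    exists 1, t; split=> //=; first by lia.
    rewrite (@ststepE_id _ _ _ (SGo (inord e)) MvS) //=.
    move: htop; rewrite Ei /= E => ->.
    by case: (hs 0) => ->.
  have hs' := on_tape_pop hs Ei.
  set x := inr _ in hs'; set t' := write _ _ _ in hs'.
  exists ((size r).+1 + (1 + (1 + h))), t'; split=> //.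
    by rewrite /h Ei /= in hh *; lia.
  rewrite !iterD hsc /= (@ststepE_id _ _ _ (SBack pc) MvL) //=; last first.
    rewrite E /h htop; case: (hs (size (get i s))) => -> _.
    by rewrite Ei.
  rewrite /h Ei /= (@ststepE _ _ _ (SRet (inord (if b then u else f))) x MvS) //=; last first.
    rewrite E; case: (hs (size r)) => _ ->.
    by rewrite Ei rev_cons onth_rcons size_rev eqxx.
  by rewrite -/t' -iterS return_left // => j; case: (hs' j).
- exists 1, t; split=> //=; first by lia.
  by rewrite (@ststepE_id _ _ _ (SGo (inord n)) MvS) //= E.
Qed.

(** An instruction raises the total height by at most one, so [height s + n] bounds it
    throughout. *)
Lemma stack_sim n pc s t :
    (forall m, m < n -> control (fetch (iter m istep (pc, s)).1)) -> on_tape s t ->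
  exists k t', [/\ k <= n * (2 * (height s + n) + 4),
    iter k ststep (SGo pc, 0, t) = (SGo (iter n istep (pc, s)).1, 0, t')
    & on_tape (iter n istep (pc, s)).2 t'].
Proof.
move=> + hs; elim: n => [|n IH] hc; first by exists 0, t.
have [m hm|k [t1 [hk hr ht1]]] := IH; first by apply: hc; lia.
have hh : height (iter n istep (pc, s)).2 <= height s + n.
  elim: n {IH hc k t1 hk hr ht1} => [|n IHn]; first by rewrite addn0.
  by rewrite iterS; have := height_istep (iter n istep (pc, s)); lia.
have := @stack_sim1 (iter n istep (pc, s)).1 _ _ (hc n (ltnSn n)) ht1.
rewrite -surjective_pairing -iterS => -[k2 [t2 [hk2 hr2 ht2]]].
exists (k2 + k), t2; split=> //; last by rewrite iterD hr.
by nia.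
Qed.

(** With the bottom in cell 0, the untouched input word is a stack whose top is its last bit. *)
Definition entry (w : seq bool) : stacks := (rev w, [::], [::], [::]).

Lemma stack_sim_start w : exists t,
  iter 1 ststep (a_init _ SStart w) = (SGo ord0, 0, t) /\ on_tape (entry w) t.
Proof.
rewrite /= (@ststepE _ _ _ (SGo ord0) (inr (true, (onth w 0, None, None, None))) MvS) //.
eexists; split; first by [].
move=> j; rewrite /write; case: eqP => [->|_] /=; split=> //;
  by case=> [[] []] //=; rewrite ?revK ?onth0n.
Qed.

Lemma stack_sim_halt pc t b :
  fetch pc = IHalt b -> (iter 1 ststep (SGo pc, 0, t)).1.1 = SHalt b.
Proof. by move=> E; rewrite /= (@ststepE_id _ _ _ (SHalt b) MvS) //= E. Qed.

(** The last move goes left from cell 0 and so stays there: the head halts at the start of the word,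
    where [output] begins to read. *)
Lemma write_out t h :
    (forall j, (cell_of (t j)).1 = (j == 0)) ->
  iter h.+1 ststep (SOut, h, t) =
    (SHalt true, 0, fun j => if j <= h then inl (get (false, false) (cell_of (t j)).2) else t j).
Proof.
elim: h t => [|h IH] t ht.
  rewrite /= (@ststepE _ _ _ (SHalt true) (inl (get (false, false) (cell_of (t 0)).2)) MvL) //=.
    congr (_, _); apply: functional_extensionality => j.
    by rewrite /write leqn0; case: eqP => // ->.
  by rewrite ht.
rewrite iterSr (@ststepE _ _ _ SOut (inl (get (false, false) (cell_of (t h.+1)).2)) MvL) //=;
  last by rewrite ht.
rewrite -iterS IH.
  congr (_, _); apply: functional_extensionality => j; rewrite /write.
  case: (ltngtP j h.+1) => [hj|hj|->].
  - by rewrite -ltnS hj.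
  - by rewrite leqNgt (ltnW hj).
  - by rewrite ltnn.
move=> j; rewrite /write; case: eqP => [->|] //.
Qed.

Lemma stack_sim_out pc t s : fetch pc = IOut -> on_tape s t ->
  exists n t', [/\ n <= 2 * height s + 4,
    iter n ststep (SGo pc, 0, t) = (SHalt true, 0, t')
    & forall j, j <= size (get (false, false) s) ->
        t' j = inl (onth (rev (get (false, false) s)) j)].
Proof.
move=> E hs; pose D : idx := (false, false); pose h := size (get D s).
have hh := size_get_height D s; have htop := on_tape_top D hs.
have hsc : iter h ststep (SGo pc, 0, t) = (SGo pc, h, t).
  by apply: scan_right hs _ => x [b' hb]; rewrite /= E hb.
case: (posnP h) => [h0|hpos].
  exists 1, (write t 0 (inl None)); split; first by lia.
    rewrite /= (@ststepE _ _ _ (SHalt true) (inl None) MvS) //=.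
    by move: htop; rewrite -/h h0 E => ->; case: (hs 0) => ->.
  move=> j; rewrite -/D -/h h0 leqn0 => /eqP ->; rewrite /write eqxx.
  by rewrite onth_default // size_rev -/h h0.
(* The blank written just above the stack ends the output word; [SOut] then starts from cell
   [h.-1]. *)
pose t1 := write t h (inl None).
have ht1 j : (cell_of (t1 j)).1 = (j == 0).
  rewrite /t1 /write; case: eqP => [->|_]; last by case: (hs j).
  by rewrite /=; case: (h) hpos.
exists (h + (1 + h)), (fun j => if j <= h.-1 then inl (get D (cell_of (t1 j)).2) else t1 j).
split; first by rewrite -/h in hh; lia.
  rewrite !iterD hsc /= (@ststepE _ _ _ SOut (inl None) MvL) //=.
    by rewrite -{1}(prednK hpos) write_out.
  by rewrite E htop; case: (hs h) => ->; case: (h) hpos.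
move=> j hj; rewrite /t1 /write; case: eqP => [->|nj].
  by rewrite onth_default ?size_rev // leqNgt prednK // leqnn.
rewrite -ltnS prednK // ltn_neqAle hj andbT; move/eqP: nj => -> /=.
by case: (hs j) => _ ->.
Qed.

End StackMachine.

(** * Polynomial bounds *)

(** A base of at least 2 absorbs constants: [c <= 2 ^ c], and a sum of two powers costs one more
    factor. These bounds are also monotone, which compositions rely on. *)
Definition poly (p : nat -> nat) : Prop := exists k, forall n, p n <= n.+2 ^ k.

Lemma poly_le p q : (forall n, p n <= q n) -> poly q -> poly p.
Proof. by move=> h [k hk]; exists k => n; apply: leq_trans (h n) (hk n). Qed.

Lemma poly_cst c : poly (fun=> c).
Proof.
exists c => n; apply: (@leq_trans (2 ^ c)); first exact: ltnW (ltn_expl _ _).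
by case: c => // c; rewrite leq_exp2r.
Qed.

Lemma poly_id : poly id.
Proof. by exists 1 => n; rewrite expn1; lia. Qed.

Lemma poly_add p q : poly p -> poly q -> poly (fun n => p n + q n).
Proof.
move=> [k hk] [l hl]; exists (maxn k l).+1 => n; rewrite expnS.
have h1 : n.+2 ^ k <= n.+2 ^ maxn k l by rewrite leq_exp2l // leq_maxl.
have h2 : n.+2 ^ l <= n.+2 ^ maxn k l by rewrite leq_exp2l // leq_maxr.
by have := hk n; have := hl n; nia.
Qed.

Lemma poly_mul p q : poly p -> poly q -> poly (fun n => p n * q n).
Proof. by move=> [k hk] [l hl]; exists (k + l) => n; rewrite expnD leq_mul. Qed.

Lemma poly_exp p k : poly p -> poly (fun n => p n ^ k).
Proof.
move=> hp; elim: k => [|k IH]; first exact: (poly_cst 1).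
by apply: poly_le (poly_mul hp IH) => n; rewrite expnS.
Qed.

Lemma poly_pow k : poly (fun n => n.+2 ^ k).
Proof. by exists k. Qed.

Lemma poly_pow_comp k p : poly p -> poly (fun n => (p n).+2 ^ k).
Proof.
by move=> hp; apply/poly_exp/(poly_le _ (poly_add hp (poly_cst 2))) => n; rewrite addn2.
Qed.

Lemma poly_poly_bound p : poly p -> exists K, forall n, p n <= poly_bound K n.
Proof.
(* The inequality [n + 2 <= 3 * n] for positive [n] explains [3 ^ k]; the summand [k] makes the
   exponent at least [k]. *)
case=> k hk; exists (3 ^ k + k) => n; apply: leq_trans (hk n) _; rewrite /poly_bound.
have h23 : 2 ^ k <= 3 ^ k by case: k {hk} => // k; rewrite leq_exp2r.
case: n => [|n]; first by lia.
apply: (@leq_trans (3 ^ k * n.+1 ^ k)).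
  by rewrite -expnMn; case: k {hk h23} => // k; rewrite leq_exp2r //; lia.
have : n.+1 ^ k <= n.+1 ^ (3 ^ k + k) by rewrite leq_pexp2l // leq_addl.
by nia.
Qed.

Lemma poly_bound_poly k : poly (poly_bound k).
Proof.
apply: poly_add (poly_mul (poly_cst k) (poly_exp k poly_id)) (poly_cst k).
Qed.

Ltac poly_tac := repeat first
  [ exact: poly_id | exact: poly_cst | exact: poly_pow | exact: poly_bound_poly
  | apply: poly_add | apply: poly_mul | apply: poly_pow_comp | apply: poly_exp ].

(** * Structured stack programs *)

Inductive cmd :=
  | Skip
  | Push of idx & bool
  | Seq of cmd & cmd
  | Case of idx & cmd & cmd & cmd
  | Loop of idx & bool & cmd & cmd.

(* [Case i] pops stack [i] and branches on empty / false / true.  [Loop i stop]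
   repeats this until the stack is empty or, if [stop], until false is popped. *)
Inductive exec : cmd -> stacks -> nat -> stacks -> Prop :=
  | ExSkip s : exec Skip s 1 s
  | ExPush i b s : exec (Push i b) s 1 (set i (b :: get i s) s)
  | ExSeq c1 c2 s1 n1 s2 n2 s3 :
      exec c1 s1 n1 s2 -> exec c2 s2 n2 s3 -> exec (Seq c1 c2) s1 (n1 + n2) s3
  | ExCaseE i ce cf ct s n s' :
      get i s = [::] -> exec ce s n s' -> exec (Case i ce cf ct) s n.+1 s'
  | ExCaseB i ce cf ct s b r n s' :
      get i s = b :: r -> exec (if b then ct else cf) (set i r s) n s' ->
      exec (Case i ce cf ct) s n.+1 s'
  | ExLoopE i stop cf ct s :
      get i s = [::] -> exec (Loop i stop cf ct) s 1 s
  | ExLoopStop i cf ct s r :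
      get i s = false :: r -> exec (Loop i true cf ct) s 1 (set i r s)
  | ExLoopB i stop cf ct s b r n1 s1 n2 s2 :
      get i s = b :: r -> b || ~~ stop ->
      exec (if b then ct else cf) (set i r s) n1 s1 ->
      exec (Loop i stop cf ct) s1 n2 s2 ->
      exec (Loop i stop cf ct) s (1 + (n1 + n2)) s2.

(** A step pushes at most one bit, so running time also bounds the growth of the data. *)
Lemma exec_height c s n s' : exec c s n s' -> height s' <= height s + n.
Proof.
elim=> {c s n s'}.
- by move=> s; lia.
- by move=> i b s; have := height_set i (b :: get i s) s; rewrite /=; lia.
- by move=> *; lia.
- by move=> *; lia.
- move=> i ce cf ct s b r n s' hi _.
  by have := height_set i r s; rewrite hi /=; lia.
- by move=> *; lia.
- move=> i cf ct s r hi.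
  by have := height_set i r s; rewrite hi /=; lia.
- move=> i stop cf ct s b r n1 s1 n2 s2 hi _ _ IH1 _ IH2.
  by have := height_set i r s; rewrite hi /=; lia.
Qed.

Fixpoint code_size (c : cmd) : nat :=
  match c with
  | Skip | Push _ _ => 1
  | Seq c1 c2 => code_size c1 + code_size c2
  | Case _ ce cf ct => (code_size ce + (code_size cf + code_size ct)).+1
  | Loop _ _ cf ct => (code_size cf + code_size ct).+1
  end.

(** The code is laid out from address [pc] and leaves at address [nxt]; the branches of a loop leave
    at the head of the loop. *)
Fixpoint compile (c : cmd) (pc nxt : nat) : seq instr :=
  match c with
  | Skip => [:: INop nxt]
  | Push i b => [:: IPush i b nxt]
  | Seq c1 c2 => let pc2 := pc + code_size c1 in compile c1 pc pc2 ++ compile c2 pc2 nxt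
  | Case i ce cf ct =>
      let pf := pc.+1 + code_size ce in let pt := pf + code_size cf in
      IPop i pc.+1 pf pt :: compile ce pc.+1 nxt ++ compile cf pf nxt ++ compile ct pt nxt
  | Loop i stop cf ct =>
      let pt := pc.+1 + code_size cf in
      IPop i nxt (if stop then nxt else pc.+1) pt :: compile cf pc.+1 pc ++ compile ct pt pc
  end.

Lemma size_compile c pc nxt : size (compile c pc nxt) = code_size c.
Proof.
elim: c pc nxt => //=.
- by move=> c1 IH1 c2 IH2 pc nxt; rewrite size_cat IH1 IH2.
- by move=> i ce IHe cf IHf ct IHt pc nxt; rewrite !size_cat IHe IHf IHt.
- by move=> i stop cf IHf ct IHt pc nxt; rewrite !size_cat IHf IHt.
Qed.

(** * Correctness of the compiler *)

Section CompilerCorrectness.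

Variable P : seq instr.

Definition code_at (pc : nat) (C : seq instr) : Prop :=
  exists pre post, P = pre ++ C ++ post /\ size pre = pc.

Lemma code_at_catl pc C1 C2 : code_at pc (C1 ++ C2) -> code_at pc C1.
Proof. by move=> [pre [post [hP hs]]]; exists pre, (C2 ++ post); rewrite hP !catA. Qed.

Lemma code_at_catr pc C1 C2 : code_at pc (C1 ++ C2) -> code_at (pc + size C1) C2.
Proof.
move=> [pre [post [hP hs]]]; exists (pre ++ C1), post.
by rewrite size_cat hs hP !catA.
Qed.

Lemma fetch_code_at pc I C : code_at pc (I :: C) -> @fetch P (inord pc) = I.
Proof.
move=> [pre [post [hP hs]]]; rewrite /fetch inordK.
  by rewrite hP nth_cat hs ltnn subnn.
by rewrite hP !size_cat /= hs; lia.
Qed.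

(** The second condition keeps [IHalt] and [IOut] off the way: [istep] idles on them, whereas the
    tape machine does not. *)
Definition reaches n (c c' : 'I_(size P).+1 * stacks) : Prop :=
  iter n (@istep P) c = c' /\ forall m, m < n -> control (fetch (iter m (@istep P) c).1).

Lemma reaches_trans n1 n2 c1 c2 c3 :
  reaches n1 c1 c2 -> reaches n2 c2 c3 -> reaches (n1 + n2) c1 c3.
Proof.
move=> [h1 hc1] [h2 hc2]; split; first by rewrite addnC iterD h1.
move=> m hm; case: (ltnP m n1) => [|hn]; first exact: hc1.
by rewrite -(subnK hn) iterD h1; apply: hc2; lia.
Qed.

Lemma reaches1 pc s : control (fetch pc) -> reaches 1 (pc, s) (istep (pc, s)).
Proof. by move=> hc; split=> // -[]. Qed.

(** [exec] charges exactly one unit per compiled instruction, so the number of steps is preserved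
    without any constant. *)
Lemma compile_correct c s n s' : exec c s n s' -> forall pc nxt,
  code_at pc (compile c pc nxt) -> reaches n (inord pc, s) (inord nxt, s').
Proof.
elim=> {c s n s'} /=.
- move=> s pc nxt /fetch_code_at E.
  by have := @reaches1 (inord pc) s; rewrite /= E; apply.
- move=> i b s pc nxt /fetch_code_at E.
  by have := @reaches1 (inord pc) s; rewrite /= E; apply.
- move=> c1 c2 s1 n1 s2 n2 s3 _ IH1 _ IH2 pc nxt hc.
  apply: reaches_trans (IH1 _ _ (code_at_catl hc)) (IH2 _ _ _).
  by have := code_at_catr hc; rewrite size_compile.
- move=> i ce cf ct s n s' hi _ IH pc nxt hc; have E := fetch_code_at hc.
  have := @reaches1 (inord pc) s; rewrite /= E hi => /(_ isT) h1.
  rewrite -add1n; apply: reaches_trans h1 (IH _ _ _).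
  by have := @code_at_catr _ [:: _] _ hc; rewrite addn1 => /code_at_catl.
- move=> i ce cf ct s b r n s' hi _ IH pc nxt hc; have E := fetch_code_at hc.
  have := @reaches1 (inord pc) s; rewrite /= E hi => /(_ isT) h1.
  rewrite -add1n; apply: reaches_trans h1 (IH _ _ _).
  have := @code_at_catr _ [:: _] _ hc; rewrite addn1 => /code_at_catr.
  rewrite size_compile; case: b {hi IH} => [/code_at_catr|/code_at_catl //].
  by rewrite size_compile.
- move=> i stop cf ct s hi pc nxt hc; have E := fetch_code_at hc.
  by have := @reaches1 (inord pc) s; rewrite /= E hi => /(_ isT).
- move=> i cf ct s r hi pc nxt hc; have E := fetch_code_at hc.
  by have := @reaches1 (inord pc) s; rewrite /= E hi => /(_ isT).
- move=> i stop cf ct s b r n1 s1 n2 s2 hi hb _ IH1 _ IH2 pc nxt hc.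
  have E := fetch_code_at hc.
  have := @reaches1 (inord pc) s; rewrite /= E hi => /(_ isT) h1.
  apply: reaches_trans h1 _; apply: (reaches_trans _ (IH2 _ _ hc)).
  have := @code_at_catr _ [:: _] _ hc; rewrite addn1.
  case: b hb IH1 {hi} => [_|/= /negbTE ->] IH1 => [/code_at_catr|/code_at_catl].
    by rewrite size_compile; apply: IH1.
  exact: IH1.
Qed.

End CompilerCorrectness.

(** * From stack programs to the classes P and FP *)

Lemma stack_run_halts (P : seq instr) w n m c :
    let ts := tstep (a_halts (inl (inr true)) (inl (inr false))) (@sdelta P) in
    iter m ts (a_init _ (inl (inl tt)) w) = c ->
    a_halts (inl (inr true)) (inl (inr false)) c.1.1 -> m <= n ->
  iter n ts (a_init _ (inl (inl tt)) w) = c.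
Proof. by move=> ts hm hc hn; rewrite -(subnK hn) iterD hm iter_tstep_halted. Qed.

Definition sD : idx := (false, false).
Definition sX : idx := (false, true).
Definition sY : idx := (true, false).
Definition sZ : idx := (true, true).

Lemma height_entry w : height (entry w) = size w.
Proof. by rewrite /= size_rev !addn0. Qed.

(** The answer is the top bit of the data stack; an epilogue pops it and jumps to one of two halting
    instructions. *)
Lemma decider_in_P (c : cmd) (f : seq bool -> bool) p :
    poly p ->
    (forall w, exists n s, [/\ n <= p (size w), exec c (entry w) n s
                            & exists r, get sD s = f w :: r]) ->
  in_P (fun w => f w).
Proof.
move=> hp hc; pose L := code_size c.
pose P := compile c 0 L ++ [:: IPop sD L.+1 L.+1 L.+2; IHalt false; IHalt true].
have hP0 : code_at P 0 (compile c 0 L) by exists [::], [:: IPop sD L.+1 L.+1 L.+2; IHalt false; IHalt true].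
have hP1 : code_at P L [:: IPop sD L.+1 L.+1 L.+2; IHalt false; IHalt true].
  by exists (compile c 0 L), [::]; rewrite cats0 size_compile.
have hP2 : code_at P L.+1 [:: IHalt false; IHalt true].
  by have := @code_at_catr _ _ [:: _] _ hP1; rewrite addn1.
have hP3 : code_at P L.+2 [:: IHalt true].
  by have := @code_at_catr _ _ [:: _] _ hP2; rewrite addn1.
(* Two steps mark cell 0 and execute [IHalt]; the [p n + 1] simulated instructions include the
   [IPop] of the epilogue. *)
pose q n := 2 + (p n + 1) * (2 * (n + (p n + 1)) + 4).
have [|K hK] := @poly_poly_bound q; first by rewrite /q; poly_tac.
exists (smachine P), K => w /=.
have [n [s [hn hs [r hr]]]] := hc w.
have h1 := compile_correct hs hP0.
have := @reaches1 P (inord L) s; rewrite /= (fetch_code_at hP1) hr => /(_ isT) h2.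
have [h3 hctl] := reaches_trans h1 h2.
have [t0 [ht0 hon0]] := stack_sim_start P w.
have e0 : inord 0 = ord0 :> 'I_(size P).+1 by apply: val_inj; rewrite /= inordK.
rewrite e0 in h3 hctl.
have [k [t [hk hrun _]]] := stack_sim hctl hon0.
rewrite h3 /= in hrun.
have hf : @fetch P (inord (if f w then L.+2 else L.+1)) = IHalt (f w).
  by case: (f w); [apply: fetch_code_at hP3 | apply: fetch_code_at hP2].
have h4 := stack_sim_halt t hf.
set ts := tstep _ _ in ht0 hrun h4.
have hm : iter (1 + (k + 1)) ts (a_init _ (inl (inl tt)) w)
          = iter 1 ts (inr (inl (inord (if f w then L.+2 else L.+1), None)), 0, t).
  by rewrite [LHS]iterD; congr (iter _ _ _); rewrite iterD ht0.
have hle : 1 + (k + 1) <= poly_bound K (size w).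
  apply: leq_trans (hK _); rewrite /q.
  rewrite height_entry in hk.
  have : (n + 1) * (2 * (size w + (n + 1)) + 4)
     <= (p (size w) + 1) * (2 * (size w + (p (size w) + 1)) + 4) by apply: leq_mul; lia.
  by lia.
have hend := stack_run_halts hm _ hle; have {}hend := hend ltac:(by rewrite h4; case: (f w)).
rewrite machine_halted machine_state hend h4; split; first by case: (f w).
by rewrite (can_eq (@enc_stateK _ (inl (inl tt)))); case: (f w); split.
Qed.

(** The output is read from cell 0, where the bottom of the stack lies; hence [rev]. *)
Lemma transducer_in_FP (c : cmd) (f : seq bool -> seq bool) p :
    poly p ->
    (forall w, exists n s, [/\ n <= p (size w), exec c (entry w) n s
                            & get sD s = rev (f w)]) ->
  in_FP f.
Proof.
move=> hp hc; pose L := code_size c.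
pose P := compile c 0 L ++ [:: IOut].
have hP0 : code_at P 0 (compile c 0 L) by exists [::], [:: IOut].
have hP1 : code_at P L [:: IOut].
  by exists (compile c 0 L), [::]; rewrite cats0 size_compile.
(* The last summand is the cost of [IOut] on stacks of height at most [n + p n]. *)
pose q n := 1 + (p n * (2 * (n + p n) + 4) + (2 * (n + p n) + 4)).
have [|K hK] := @poly_poly_bound q; first by rewrite /q; poly_tac.
exists (smachine P), K => w /=.
have [n [s [hn hs hr]]] := hc w.
have [h3 hctl] := compile_correct hs hP0.
have [t0 [ht0 hon0]] := stack_sim_start P w.
have e0 : inord 0 = ord0 :> 'I_(size P).+1 by apply: val_inj; rewrite /= inordK.
rewrite e0 in h3 hctl.
have [k [t [hk hrun hon]]] := stack_sim hctl hon0.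
rewrite h3 /= in hrun hon.
have [k2 [t2 [hk2 hrun2 ht2]]] := stack_sim_out (fetch_code_at hP1) hon.
set ts := tstep _ _ in ht0 hrun hrun2.
have hm : iter (k2 + (k + 1)) ts (a_init _ (inl (inl tt)) w)
          = (inl (inr true), 0, t2).
  by rewrite !iterD ht0 hrun.
have hle : k2 + (k + 1) <= poly_bound K (size w).
  apply: leq_trans (hK _); rewrite /q.
  have hh := exec_height hs.
  rewrite height_entry in hk hh.
  have : n * (2 * (size w + n) + 4)
     <= p (size w) * (2 * (size w + p (size w)) + 4) by apply: leq_mul; lia.
  by lia.
have hend := stack_run_halts hm isT hle.
split; first by rewrite machine_halted hend.
apply: machine_output; rewrite hend /= => j hj.
by rewrite add0n ht2 -/sD hr ?revK // size_rev.
Qed.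

Definition execle (c : cmd) (s : stacks) (n : nat) (s' : stacks) : Prop :=
  exists2 m, m <= n & exec c s m s'.

Lemma execle_leq c s m n s' : execle c s m s' -> m <= n -> execle c s n s'.
Proof. by move=> [k hk he] hm; exists k => //; apply: leq_trans hm. Qed.

Lemma execle_skip s : execle Skip s 1 s.
Proof. by exists 1 => //; constructor. Qed.

Lemma execle_push i b s : execle (Push i b) s 1 (set i (b :: get i s) s).
Proof. by exists 1 => //; constructor. Qed.

Lemma execle_seq c1 c2 s1 s2 s3 n1 n2 :
  execle c1 s1 n1 s2 -> execle c2 s2 n2 s3 -> execle (Seq c1 c2) s1 (n1 + n2) s3.
Proof.
move=> [m1 h1 e1] [m2 h2 e2]; exists (m1 + m2); first exact: leq_add.
exact: ExSeq e1 e2.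
Qed.

Lemma execle_case i ce cf ct s b r n s' :
    get i s = b :: r -> execle (if b then ct else cf) (set i r s) n s' ->
  execle (Case i ce cf ct) s n.+1 s'.
Proof. by move=> hi [m hm he]; exists m.+1 => //; apply: ExCaseB he. Qed.

Lemma execle_loopE i stop cf ct s :
  get i s = [::] -> execle (Loop i stop cf ct) s 1 s.
Proof. by move=> hi; exists 1 => //; constructor. Qed.

Lemma execle_loop_stop i cf ct s r :
  get i s = false :: r -> execle (Loop i true cf ct) s 1 (set i r s).
Proof. by move=> hi; exists 1 => //; constructor. Qed.

Lemma execle_loop i stop cf ct s b r n1 s1 n2 s2 :
    get i s = b :: r -> b || ~~ stop -> execle (if b then ct else cf) (set i r s) n1 s1 ->
    execle (Loop i stop cf ct) s1 n2 s2 ->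
  execle (Loop i stop cf ct) s (1 + (n1 + n2)) s2.
Proof.
move=> hi hb [m1 h1 e1] [m2 h2 e2]; exists (1 + (m1 + m2)); first by lia.
exact: ExLoopB hi hb e1 e2.
Qed.

Definition pushes (i : idx) (u : seq bool) : cmd :=
  foldr (fun b c => Seq c (Push i b)) Skip u.

Lemma execle_pushes i u s : execle (pushes i u) s (size u).+1 (set i (u ++ get i s) s).
Proof.
elim: u => [|b u IH] /=.
  have -> : set i (get i s) s = s by case: s => [[[? ?] ?] ?]; case: i => [[] []].
  exact: execle_skip.
have := execle_push i b (set i (u ++ get i s) s).
rewrite get_set eqxx set_set => hb.
by apply: execle_leq (execle_seq IH hb) _; lia.
Qed.

(** A transfer reverses, so keeping the order takes two of them. *)
Definition transfer (i j : idx) : cmd := Loop i false (Push j false) (Push j true).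

Lemma execle_transfer i j x s : i != j -> get i s = x ->
  execle (transfer i j) s (2 * size x + 1) (set j (catrev x (get j s)) (set i [::] s)).
Proof.
move=> hij; elim: x s => [|b x IH] s hi.
  have -> : set j (catrev [::] (get j s)) (set i [::] s) = s.
    case: s hi => [[[? ?] ?] ?]; case: i j hij => [[] []] [[] []] //= _ -> //.
  exact: execle_loopE.
have hp : execle (if b then Push j true else Push j false) (set i x s) 1
                 (set j (b :: get j s) (set i x s)).
  have -> : get j s = get j (set i x s) by rewrite get_set eq_sym (negbTE hij).
  by case: b {hi}; apply: execle_push.
have [|m hm he] := IH (set j (b :: get j s) (set i x s)).
  by rewrite !get_set eqxx (negbTE hij).
apply: execle_leq (execle_loop hi _ hp _) _; first by case: b {hi hp hm he}.
  exists m; first exact: hm.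
  have <- : set j (catrev x (get j (set j (b :: get j s) (set i x s))))
                  (set i [::] (set j (b :: get j s) (set i x s)))
     = set j (catrev (b :: x) (get j s)) (set i [::] s).
    by clear; case: s => [[[? ?] ?] ?]; case: i j => [[] []] [[] []].
  exact: he.
by rewrite /=; lia.
Qed.

(** * Binary trees on a stack *)

Inductive tree := Leaf | Node of tree & tree.

Fixpoint code (t : tree) : seq bool :=
  if t is Node a b then true :: code a ++ code b else [:: false].

Lemma code_cat_inj t1 t2 r1 r2 : code t1 ++ r1 = code t2 ++ r2 -> t1 = t2 /\ r1 = r2.
Proof.
elim: t1 t2 r1 r2 => [|a1 IHa b1 IHb] [|a2 b2] r1 r2 //=; first by case.
by case; rewrite -!catA => /IHa[-> /IHb[-> ->]].
Qed.

Lemma code_inj : injective code.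
Proof.
move=> t1 t2 h; have := @code_cat_inj t1 t2 [::] [::].
by rewrite !cats0 h => /(_ erefl)[].
Qed.

Lemma size_code_gt0 t : 0 < size (code t).
Proof. by case: t. Qed.

Definition dstack (u : seq bool) : stacks := (u, [::], [::], [::]).

(** [aux false] is [sX] and [aux true] is [sZ]: a tree can be moved to one while the other keeps a
    saved tree. *)
Definition aux (j : bool) : idx := (j, true).

(* Stack [sY] counts, in unary, the subtrees still to be read from stack [sD]. *)
Definition move_body (j : bool) : cmd :=
  Case sD Skip (Push (aux j) false)
    (Seq (Push (aux j) true) (Seq (Push sY true) (Push sY true))).

Definition move_loop (j : bool) : cmd := Loop sY false Skip (move_body j).

Definition move_tree (j : bool) : cmd := Seq (Push sY true) (move_loop j).

Definition mstate (j : bool) (u x y z : seq bool) : stacks :=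
  if j then (u, z, y, x) else (u, x, y, z).

(** An arbitrary rest of the loop is assumed, so that reading the right subtree can serve as the
    continuation of reading the left one. The factor 5 is the cost of one iteration at a [Node]. *)
Lemma execle_move_loop j t u x z m n s :
    execle (move_loop j) (mstate j u (catrev (code t) x) (nseq m true) z) n s ->
  execle (move_loop j) (mstate j (code t ++ u) x (nseq m.+1 true) z)
    (5 * size (code t) + n) s.
Proof.
elim: t u x m n s => [|a IHa b IHb] u x m n s h.
  apply: execle_leq (@execle_loop _ _ _ _ _ true (nseq m true) 2
    (mstate j u (false :: x) (nseq m true) z) n s _ _ _ h) _ => //=.
  - by case: (j).
  - apply: (@execle_case _ _ _ _ _ false u); first by case: (j).
    have := execle_push (aux j) false (set sD u (set sY (nseq m true)
       (mstate j (false :: u) x (true :: nseq m true) z))).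
    by case: (j).
  - by lia.
rewrite /= catrev_catl in h.
have {h IHa IHb} h := IHa _ _ _ _ _ (IHb _ _ _ _ _ h).
apply: execle_leq (@execle_loop _ _ _ _ _ true (nseq m true) 4 _ _ s _ _ _ h) _ => //=.
- by case: (j).
- apply: (@execle_case _ _ _ _ _ true (code a ++ code b ++ u)); first by case: (j); rewrite /= catA.
  have h1 := execle_push (aux j) true (mstate j (code a ++ code b ++ u) x (nseq m true) z).
  have h2 := execle_push sY true (mstate j (code a ++ code b ++ u) (true :: x) (nseq m true) z).
  have h3 := execle_push sY true (mstate j (code a ++ code b ++ u) (true :: x) (nseq m.+1 true) z).
  by case: (j) h1 h2 h3 => h1 h2 h3; apply: execle_seq h1 (execle_seq h2 h3).
- by rewrite size_cat; lia.
Qed.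

Lemma execle_move_tree j t u z :
  execle (move_tree j) (mstate j (code t ++ u) [::] [::] z) (5 * size (code t) + 2)
         (mstate j u (rev (code t)) [::] z).
Proof.
have h0 : execle (move_loop j) (mstate j u (catrev (code t) [::]) [::] z) 1
                 (mstate j u (rev (code t)) [::] z).
  by apply: execle_loopE; case: (j).
have h1 := execle_move_loop (m := 0) h0.
have h2 := execle_push sY true (mstate j (code t ++ u) [::] [::] z).
apply: execle_leq (execle_seq h2 (s3 := mstate j u (rev (code t)) [::] z) _) _.
- by case: (j) h1 => h1; apply: h1.
- by lia.
Qed.

Definition drop_tree : cmd := Seq (move_tree false) (Loop sX false Skip Skip).

Lemma execle_drain x u : execle (Loop sX false Skip Skip) (u, x, [::], [::]) (2 * size x + 1) (dstack u).
Proof.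
elim: x => [|b x IH]; first exact: execle_loopE.
apply: execle_leq (@execle_loop _ _ _ _ _ b x 1 _ _ _ _ _ _ IH) _ => //.
- by case: b.
- by case: b; apply: execle_skip.
- by rewrite /=; lia.
Qed.

Lemma execle_drop_tree t u :
  execle drop_tree (dstack (code t ++ u)) (7 * size (code t) + 3) (dstack u).
Proof.
apply: execle_leq (execle_seq (execle_move_tree false t u [::]) (execle_drain _ _)) _.
by rewrite size_rev; lia.
Qed.

Definition copy_loop : cmd :=
  Loop sX false (Seq (Push sD false) (Push sZ false)) (Seq (Push sD true) (Push sZ true)).

Lemma execle_copy_loop x u z : execle copy_loop (u, x, [::], z) (3 * size x + 1)
  (catrev x u, [::], [::], catrev x z).
Proof.
elim: x u z => [|b x IH] u z; first exact: execle_loopE.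
apply: execle_leq (@execle_loop _ _ _ _ _ b x 2 _ _ _ _ _ _ (IH (b :: u) (b :: z))) _ => //.
- by case: b.
- have h1 := execle_push sD b (u, x, [::], z).
  have h2 := execle_push sZ b (b :: u, x, [::], z).
  by case: b h1 h2 => h1 h2; apply: execle_seq h1 h2.
- by rewrite /=; lia.
Qed.

Definition dup_tree : cmd :=
  Seq (move_tree false) (Seq copy_loop (Seq (transfer sZ sX) (transfer sX sD))).

Lemma execle_dup_tree t u :
  execle dup_tree (dstack (code t ++ u)) (12 * size (code t) + 5)
         (dstack (code t ++ code t ++ u)).
Proof.
have h1 := execle_move_tree false t u [::].
have h2 := execle_copy_loop (rev (code t)) u [::].
rewrite -/(rev (rev (code t))) catrevE !revK in h2.
have h3 := @execle_transfer sZ sX (code t) (code t ++ u, [::], [::], code t) isT erefl.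
have h4 := @execle_transfer sX sD (rev (code t)) (code t ++ u, rev (code t), [::], [::]) isT erefl.
rewrite /= catrevE revK in h4.
apply: execle_leq (execle_seq h1 (execle_seq h2 (execle_seq h3 h4))) _.
by rewrite size_rev; lia.
Qed.

Definition swap_trees : cmd :=
  Seq (move_tree false) (Seq (move_tree true) (Seq (transfer sX sD) (transfer sZ sD))).

Lemma execle_swap_trees t1 t2 u :
  execle swap_trees (dstack (code t1 ++ code t2 ++ u)) (7 * (size (code t1) + size (code t2)) + 6)
         (dstack (code t2 ++ code t1 ++ u)).
Proof.
have h1 := execle_move_tree false t1 (code t2 ++ u) [::].
have h2 := execle_move_tree true t2 u (rev (code t1)).
have h3 := @execle_transfer sX sD (rev (code t1)) (u, rev (code t1), [::], rev (code t2)) isT erefl.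
have h4 := @execle_transfer sZ sD (rev (code t2))
  (code t1 ++ u, [::], [::], rev (code t2)) isT erefl.
rewrite /= catrevE revK in h3; rewrite /= catrevE revK in h4.
apply: execle_leq (execle_seq h1 (execle_seq h2 (execle_seq h3 h4))) _.
by rewrite !size_rev; lia.
Qed.

Definition pop : cmd := Case sD Skip Skip Skip.

Lemma execle_pop b u : execle pop (dstack (b :: u)) 2 (dstack u).
Proof. by apply: (@execle_case _ _ _ _ _ b u) => //; case: b; apply: execle_skip. Qed.

(** * Polynomial-time functions on encoded data *)

Class encodable (A : Type) := { enc : A -> tree; enc_inj : injective enc }.

Definition esize A {eA : encodable A} (a : A) : nat := size (code (enc a)).

(** The remainder [u] of the stack is left alone, so that saved values may lie below the argument.
    Monotonicity of [p] turns bounds on argument sizes into bounds on time. *)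
Definition PF A B {eA : encodable A} {eB : encodable B} (f : A -> B) : Prop :=
  exists c p, [/\ poly p, {homo p : m n / m <= n} &
    forall a u, execle c (dstack (code (enc a) ++ u)) (p (esize a))
                         (dstack (code (enc (f a)) ++ u))].

Lemma PF_intro A B {eA : encodable A} {eB : encodable B} (f : A -> B) c p :
    poly p ->
    (forall a u, execle c (dstack (code (enc a) ++ u)) (p (esize a))
                          (dstack (code (enc (f a)) ++ u))) ->
  PF f.
Proof.
move=> [k hk] hc; exists c, (fun n => n.+2 ^ k); split=> [||a u].
- exact: poly_pow.
- by move=> m n hmn; case: k {hk} => // k; rewrite leq_exp2r.
- exact: execle_leq (hc a u) (hk _).
Qed.

(** In time [p n] a program adds at most [p n] bits to the stack. *)
Lemma PF_esize A B {eA : encodable A} {eB : encodable B} (f : A -> B) :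
  PF f -> exists p, [/\ poly p, {homo p : m n / m <= n} & forall a, esize (f a) <= p (esize a)].
Proof.
move=> [c [p [hp hm hc]]]; exists (fun n => n + p n); split=> [||a].
- by poly_tac.
- by move=> m n h; have := hm _ _ h; lia.
have [n hn /exec_height] := hc a [::].
by rewrite /= !cats0 !addn0; rewrite /esize in hn *; lia.
Qed.

Section Encodings.

(** The first bit of the code is [b] itself: one pop tests it, and a decider finds its answer on top
    of the stack. After true, two more bits remain to be popped. *)
Definition enc_bool (b : bool) : tree := if b then Node Leaf Leaf else Leaf.
Lemma enc_bool_inj : injective enc_bool. Proof. by case; case. Qed.

Variables (A B : Type) (eA : encodable A) (eB : encodable B).

Definition enc_prod (p : A * B) : tree := Node (enc p.1) (enc p.2).
Lemma enc_prod_inj : injective enc_prod.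
Proof. by move=> [a b] [a' b'] [] /= /(@enc_inj _ eA) -> /(@enc_inj _ eB) ->. Qed.

Fixpoint enc_seq (s : seq A) : tree :=
  if s is x :: s' then Node (enc x) (enc_seq s') else Leaf.
Lemma enc_seq_inj : injective enc_seq.
Proof.
by elim=> [|x s IH] [|y s'] //= [] /(@enc_inj _ eA) -> /IH ->.
Qed.

(** This is also the tree of [nseq n false], so the conversion costs nothing. *)
Fixpoint enc_nat (n : nat) : tree :=
  if n is n'.+1 then Node Leaf (enc_nat n') else Leaf.
Lemma enc_nat_inj : injective enc_nat.
Proof. by elim=> [|n IH] [|m] //= [/IH ->]. Qed.

End Encodings.

#[export] Instance encodable_bool : encodable bool := {| enc_inj := enc_bool_inj |}.
#[export] Instance encodable_nat : encodable nat := {| enc_inj := enc_nat_inj |}.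
#[export] Instance encodable_prod A B {eA : encodable A} {eB : encodable B} :
  encodable (A * B) := {| enc_inj := @enc_prod_inj A B eA eB |}.
#[export] Instance encodable_seq A {eA : encodable A} :
  encodable (seq A) := {| enc_inj := @enc_seq_inj A eA |}.

Section EncodedSize.

Context {A B : Type} {eA : encodable A} {eB : encodable B}.

Lemma esize_pair (a : A) (b : B) : esize (a, b) = (esize a + esize b).+1.
Proof. by rewrite /esize /= size_cat. Qed.

Lemma esize_cons (x : A) s : esize (x :: s) = (esize x + esize s).+1.
Proof. by rewrite /esize /= size_cat. Qed.

Lemma esize_nil : esize ([::] : seq A) = 1.
Proof. by []. Qed.

Lemma esize_gt0 (a : A) : 0 < esize a.
Proof. exact: size_code_gt0. Qed.

Lemma esize_cat (s t : seq A) : (esize (s ++ t)).+1 = esize s + esize t.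
Proof. by elim: s => [|x s IH] //=; rewrite !esize_cons; lia. Qed.

Lemma size_esize (s : seq A) : size s < esize s.
Proof. by elim: s => [|x s IH] //=; rewrite esize_cons; lia. Qed.

End EncodedSize.

Lemma esize_nat n : esize n = (2 * n).+1.
Proof. by elim: n => [|n IH] //; rewrite /esize /= in IH *; lia. Qed.

Lemma esize_bool (b : bool) : esize b <= 3.
Proof. by case: b. Qed.

Section Combinators.

Context {A B C : Type} {eA : encodable A} {eB : encodable B} {eC : encodable C}.

Lemma PF_eq (f g : A -> B) : f =1 g -> PF f -> PF g.
Proof. by move=> hfg [c [p [hp hm hc]]]; exists c, p; split=> // a u; rewrite -hfg. Qed.

Lemma PF_id : PF (fun a : A => a).
Proof. by apply: (@PF_intro _ _ _ _ _ Skip (fun=> 1)) => [|a u]; [poly_tac | apply: execle_skip]. Qed.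

Lemma PF_comp (f : A -> B) (g : B -> C) : PF g -> PF f -> PF (fun a => g (f a)).
Proof.
move=> [cg [pg [hpg hmg hg]]] hf; have [q [hq hmq hfq]] := PF_esize hf.
move: hf => [cf [pf [hpf hmf hf]]].
have [k hk] := hpg.
apply: (@PF_intro _ _ _ _ _ (Seq cf cg) (fun n => pf n + (q n).+2 ^ k)) => [|a u]; first by poly_tac.
apply: execle_leq (execle_seq (hf a u) (hg _ u)) _; rewrite leq_add2l.
by apply: leq_trans (hk _); apply: hmg.
Qed.

(** The first swap brings the saved argument up for [cg], the second one orders the components, and
    the final push supplies the [Node]. *)
Lemma PF_pair (f : A -> B) (g : A -> C) : PF f -> PF g -> PF (fun a => (f a, g a)).
Proof.
move=> hf hg; have [qf [hqf _ hfq]] := PF_esize hf; have [qg [hqg _ hgq]] := PF_esize hg.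
move: hf => [cf [pf [hpf hmf hf]]]; move: hg => [cg [pg [hpg hmg hg]]].
pose S := swap_trees.
apply: (@PF_intro _ _ _ _ _
  (Seq dup_tree (Seq cf (Seq S (Seq cg (Seq S (Push sD true))))))
  (fun n => (12 * n + 5) + (pf n + ((7 * (qf n + n) + 6) + (pg n + ((7 * (qg n + qf n) + 6) + 1))))))
  => [|a u]; first by poly_tac.
pose proof (execle_dup_tree (enc a) u) as h1.
pose proof (hf a (code (enc a) ++ u)) as h2.
pose proof (execle_swap_trees (enc (f a)) (enc a) u) as h3.
pose proof (hg a (code (enc (f a)) ++ u)) as h4.
pose proof (execle_swap_trees (enc (g a)) (enc (f a)) u) as h5.
pose proof (execle_push sD true (dstack (code (enc (f a)) ++ code (enc (g a)) ++ u))) as h6.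
rewrite /= -catA.
apply: execle_leq (execle_seq h1 (execle_seq h2 (execle_seq h3 (execle_seq h4 (execle_seq h5 h6))))) _.
have := hfq a; have := hgq a; rewrite /esize; lia.
Qed.

Lemma PF_fst : PF (fun p : A * B => p.1).
Proof.
apply: (@PF_intro _ _ _ _ _ (Seq pop (Seq swap_trees drop_tree)) (fun n => 2 + ((7 * n + 6) + (7 * n + 3))))
  => [|[a b] u]; first by poly_tac.
rewrite /= -catA.
apply: execle_leq (execle_seq (execle_pop true _)
  (execle_seq (execle_swap_trees _ _ _) (execle_drop_tree _ _))) _.
by rewrite esize_pair /esize; lia.
Qed.

Lemma PF_snd : PF (fun p : A * B => p.2).
Proof.
apply: (@PF_intro _ _ _ _ _ (Seq pop drop_tree) (fun n => 2 + (7 * n + 3)))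
  => [|[a b] u]; first by poly_tac.
rewrite /= -catA.
apply: execle_leq (execle_seq (execle_pop true _) (execle_drop_tree _ _)) _.
by rewrite esize_pair /esize; lia.
Qed.

Lemma PF_cst (b : B) : PF (fun _ : A => b).
Proof.
apply: (@PF_intro _ _ _ _ _ (Seq drop_tree (pushes sD (code (enc b))))
   (fun n => (7 * n + 3) + (esize b).+1)) => [|a u]; first by poly_tac.
exact: execle_seq (execle_drop_tree _ _) (execle_pushes sD _ _).
Qed.

Lemma PF_if (b : A -> bool) (f g : A -> B) :
  PF b -> PF f -> PF g -> PF (fun a => if b a then f a else g a).
Proof.
move=> [cb [pb [hpb hmb hb]]] [cf [pf [hpf hmf hf]]] [cg [pg [hpg hmg hg]]].
apply: (@PF_intro _ _ _ _ _
  (Seq dup_tree (Seq cb (Case sD Skip cg (Seq pop (Seq pop cf)))))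
  (fun n => (12 * n + 5) + (pb n + (4 + pf n + pg n + 1)))) => [|a u]; first by poly_tac.
apply: execle_seq (execle_dup_tree _ _) _.
apply: execle_seq (hb a _) _.
rewrite addn1; case: (b a) => /=.
  apply: (@execle_case _ _ _ _ _ true [:: false, false & code (enc a) ++ u]) => //.
  apply: execle_leq (execle_seq (execle_pop _ _) (execle_seq (execle_pop _ _) (hf a u))) _.
  by lia.
apply: (@execle_case _ _ _ _ _ false (code (enc a) ++ u)) => //.
by apply: execle_leq (hg a u) _; lia.
Qed.

End Combinators.

Section Constructors.

Context {A B : Type} {eA : encodable A} {eB : encodable B}.

Lemma PF_cons (f : A -> B) (g : A -> seq B) : PF f -> PF g -> PF (fun a => f a :: g a).
Proof.
by move=> hf hg; case: (PF_pair hf hg) => c [p [hp hm hc]]; exists c, p.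
Qed.

Lemma PF_succ (f : A -> nat) : PF f -> PF (fun a => (f a).+1).
Proof.
by move=> hf; case: (PF_pair (PF_cst false) hf) => c [p [hp hm hc]]; exists c, p.
Qed.

End Constructors.

Section Fold.

Context {E A B : Type} {eE : encodable E} {eA : encodable A} {eB : encodable B}.

(** The list lies above the accumulator, and the loop pops its constructor bits: [Node] runs the
    body, [Leaf] stops and leaves the accumulator. Two pushed bits make element, tail and
    accumulator one triple; [c] maps it to the tail and the new accumulator, and a pop splits this
    pair. The time of an iteration depends on the current accumulator, so all prefixes need the size
    bound. *)
Lemma PF_fold (g : B -> A -> B) (xs : E -> seq A) (s0 : E -> B) q :
    PF (fun p : A * B => g p.2 p.1) -> PF xs -> PF s0 -> poly q ->
    (forall e l1 l2, xs e = l1 ++ l2 -> esize (foldl g (s0 e) l1) <= q (esize e)) ->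
  PF (fun e => foldl g (s0 e) (xs e)).
Proof.
move=> hg hl hs hq hb; have [r [hr _ hlr]] := PF_esize hl.
have [c0 [p0 [hp0 _ hc0]]] := PF_pair hl hs.
have [c [p [hp hm hc]]] : PF (fun p : (A * seq A) * B => (p.1.2, g p.2 p.1.1)).
  apply: PF_pair; first exact: PF_comp PF_snd PF_fst.
  apply: (PF_comp (f := fun p : (A * seq A) * B => (p.1.1, p.2)) hg).
  exact: PF_pair (PF_comp PF_fst PF_fst) PF_snd.
pose body := Seq (pushes sD [:: true; true]) (Seq c pop).
(* Beside [c], an iteration costs 3 for the pushes, 2 for the pop and 1 for the loop, 6 in all. *)
have step (l : seq A) s W N u : (forall l1 l2, l = l1 ++ l2 -> esize (foldl g s l1) <= N) ->
    6 + p (N + esize l).+1 <= W ->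
    execle (Loop sD true Skip body) (dstack (code (enc l) ++ code (enc s) ++ u))
      (size l * W + 1) (dstack (code (enc (foldl g s l)) ++ u)).
  elim: l s W => [|x l IH] s W hN hW /=.
    exact: execle_loop_stop.
  pose proof (execle_pushes sD [:: true; true]
               (dstack (code (enc x) ++ code (enc l) ++ code (enc s) ++ u))) as h1.
  pose proof (hc ((x, l), s) u) as h2.
  rewrite /= -!catA in h2.
  pose proof (execle_pop true (code (enc l) ++ code (enc (g s x)) ++ u)) as h3.
  pose proof (execle_seq h1 (execle_seq h2 h3)) as h4.
  have h5 : execle (Loop sD true Skip body) (dstack (code (enc l) ++ code (enc (g s x)) ++ u))
     (size l * W + 1) (dstack (code (enc (foldl g (g s x) l)) ++ u)).
    apply: IH => [l1 l2 el|]; first by apply: (hN (x :: l1) l2); rewrite el.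
    apply: leq_trans hW; rewrite leq_add2l; apply: hm.
    by rewrite esize_cons; lia.
  set R := code (enc x) ++ _ in h4; rewrite -!catA -/R.
  apply: execle_leq (@execle_loop sD true Skip body (dstack (true :: R)) true R _ _ _ _
    erefl isT h4 h5) _.
  have : p (esize (x, l, s)) <= p (N + esize (x :: l)).+1.
    apply: hm; rewrite !esize_pair esize_cons.
    by have := hN [::] (x :: l) erefl; rewrite /=; lia.
  by rewrite /= mulSn; lia.
have [k hk] := hp.
apply: (@PF_intro _ _ _ _ _ (Seq c0 (Seq pop (Loop sD true Skip body)))
   (fun n => p0 n + (2 + (r n * (6 + (q n + r n + 1).+2 ^ k) + 1)))) => [|e u]; first by poly_tac.
set n := esize e; pose proof (hc0 e u) as h0; rewrite /= -catA in h0.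
apply: execle_leq (execle_seq h0 (execle_seq (execle_pop true _)
  (step (xs e) (s0 e) (6 + (q n + r n + 1).+2 ^ k) (q n) u _ _))) _.
- by move=> l1 l2 hl12; apply: hb hl12.
- rewrite leq_add2l; apply: leq_trans (hk _); apply: hm.
  by have := hlr e; rewrite -/n; lia.
- rewrite !leq_add2l leq_add2r; apply: leq_mul => //.
  by have := hlr e; pose proof (size_esize (xs e)); rewrite -/n; lia.
Qed.

End Fold.

Section Serialization.

Context {A : Type} {eA : encodable A}.

(** On top of an encoded list this adds [b] in front; in this way raw bits become encoded data. *)
Definition push_bit (i : idx) (b : bool) : cmd := pushes i (true :: code (enc b)).

Definition list_loop (i j : idx) : cmd := Loop i false (push_bit j false) (push_bit j true).

Lemma execle_list_loop i j x l u s : i != j -> get i s = x -> get j s = code (enc l) ++ u ->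
  execle (list_loop i j) s (6 * size x + 1)
    (set j (code (enc (catrev x l)) ++ u) (set i [::] s)).
Proof.
move=> hij; elim: x l s => [|b x IH] l s hi hj.
  have -> : set j (code (enc (catrev [::] l)) ++ u) (set i [::] s) = s.
    by move: hi hj; case: s => [[[? ?] ?] ?]; case: i j hij => [[] []] [[] []] //= _ -> ->.
  exact: execle_loopE.
have hp : execle (if b then push_bit j true else push_bit j false) (set i x s) 5
                 (set j (code (enc (b :: l)) ++ u) (set i x s)).
  have hj' : get j (set i x s) = code (enc l) ++ u by rewrite get_set eq_sym (negbTE hij).
  pose proof (execle_pushes j (true :: code (enc b)) (set i x s)) as h.
  by rewrite hj' in h; case: b {hi} h => h; apply: execle_leq h _.
apply: execle_leq (execle_loop hi _ hp _) _.
- by case: b {hi hp IH}.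
- have e : set j (code (enc (catrev (b :: x) l)) ++ u) (set i [::] s)
     = set j (code (enc (catrev x (b :: l))) ++ u)
         (set i [::] (set j (code (enc (b :: l)) ++ u) (set i x s))).
    by clear; case: s => [[[? ?] ?] ?]; case: i j => [[] []] [[] []].
  by rewrite e; apply: (IH (b :: l)); rewrite !get_set eqxx ?(negbTE hij).
- by rewrite /=; lia.
Qed.

(** The code of a value becomes data itself. Equality at every encodable type thus reduces to
    equality of bit lists, and variables get bit strings as names. *)
Lemma PF_code : PF (fun a : A => code (enc a)).
Proof.
apply: (@PF_intro _ _ _ _ _ (Seq (move_tree false) (Seq (Push sD false) (list_loop sX sD)))
   (fun n => 5 * n + 2 + (1 + (6 * n + 1)))) => [|a u]; first by poly_tac.
pose proof (execle_move_tree false (enc a) u [::]) as h1.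
pose proof (execle_push sD false (u, rev (code (enc a)), [::], [::])) as h2.
pose proof (@execle_list_loop sX sD (rev (code (enc a))) [::] u
  (false :: u, rev (code (enc a)), [::], [::]) isT erefl erefl) as h3.
rewrite catrevE revK cats0 in h3.
apply: execle_leq (execle_seq h1 (execle_seq h2 h3)) _.
by rewrite size_rev /esize; lia.
Qed.

End Serialization.

Lemma esize_bits (w : seq bool) : esize w <= 4 * size w + 1.
Proof. by elim: w => [|b w IH] //=; rewrite esize_cons; pose proof (esize_bool b); lia. Qed.

Definition read_input : cmd :=
  Seq (Push sX false) (Seq (list_loop sD sX) (Seq (transfer sX sZ) (transfer sZ sD))).

Lemma execle_read_input w :
  execle read_input (entry w) (1 + (6 * size w + 1 + ((8 * size w + 3) + (8 * size w + 3))))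
    (dstack (code (enc w))).
Proof.
pose proof (execle_push sX false (entry w)) as h1.
pose proof (@execle_list_loop sD sX (rev w) [::] [::]
  (rev w, [:: false], [::], [::]) isT erefl erefl) as h2.
rewrite catrevE revK !cats0 size_rev in h2.
pose proof (esize_bits w) as hs; rewrite /esize in hs.
set e := code (enc w) in hs h2 *.
pose proof (@execle_transfer sX sZ e ([::], e, [::], [::]) isT erefl) as h3.
pose proof (@execle_transfer sZ sD (rev e) ([::], [::], [::], rev e) isT erefl) as h4.
rewrite /= catrevE revK cats0 in h4.
apply: execle_leq (execle_seq h1 (execle_seq h2 (execle_seq h3 h4))) _.
by rewrite size_rev; lia.
Qed.

Definition out_body : cmd := Case sD Skip (Push sX false) (Seq pop (Seq pop (Push sX true))).

Definition out_loop : cmd := Loop sD true Skip out_body.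

Lemma execle_out_loop (w : seq bool) x :
  execle out_loop (code (enc w), x, [::], [::]) (7 * size w + 1) ([::], catrev w x, [::], [::]).
Proof.
elim: w x => [|b w IH] x; first exact: execle_loop_stop.
have hb : execle out_body (code (enc b) ++ code (enc w), x, [::], [::]) 6
                          (code (enc w), b :: x, [::], [::]).
  case: b => /=.
    apply: (@execle_case _ _ _ _ _ true [:: false, false & code (enc w)]) => //.
    have hpop u y : execle pop (false :: u, y, [::], [::]) 2 (u, y, [::], [::]).
      by apply: (@execle_case _ _ _ _ _ false u) => //; apply: execle_skip.
    exact: execle_seq (hpop _ _) (execle_seq (hpop _ _)
             (execle_push sX true (code (enc w), x, [::], [::]))).
  apply: (@execle_case _ _ _ _ _ false (code (enc w))) => //.
  by apply: execle_leq (execle_push sX false (code (enc w), x, [::], [::])) _.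
apply: execle_leq (@execle_loop sD true Skip out_body (code (enc (b :: w)), x, [::], [::])
  true (code (enc b) ++ code (enc w)) _ _ _ _ erefl isT hb (IH (b :: x))) _.
by rewrite /=; lia.
Qed.

Lemma PF_in_FP (f : seq bool -> seq bool) : PF f -> in_FP f.
Proof.
move=> hf; have [q [hq hmq hfq]] := PF_esize hf; move: hf => [c [p [hp hm hc]]].
have [k hk] := hp; have [l hl] := hq.
pose P n := 1 + (6 * n + 1 + ((8 * n + 3) + (8 * n + 3))) + ((4 * n + 1).+2 ^ k
  + (7 * (4 * n + 1).+2 ^ l + 1 + ((2 * (4 * n + 1).+2 ^ l + 1) + (2 * (4 * n + 1).+2 ^ l + 1)))).
apply: (@transducer_in_FP (Seq read_input (Seq c (Seq out_loop
   (Seq (transfer sX sZ) (transfer sZ sD))))) f P) => [|w]; first by rewrite /P; poly_tac.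
pose proof (execle_read_input w) as h1.
pose proof (hc w [::]) as h2; rewrite !cats0 in h2.
pose proof (execle_out_loop (f w) [::]) as h3.
pose proof (@execle_transfer sX sZ (rev (f w)) ([::], rev (f w), [::], [::]) isT erefl) as h4.
rewrite /= catrevE revK cats0 in h4.
pose proof (@execle_transfer sZ sD (f w) ([::], [::], [::], f w) isT erefl) as h5.
have [n hn he] := execle_seq h1 (execle_seq h2 (execle_seq h3 (execle_seq h4 h5))).
refine (ex_intro _ n (ex_intro _ _ (And3 _ he _))); last by [].
pose proof (esize_bits w) as hw.
have h6 : p (esize w) <= (4 * size w + 1).+2 ^ k by apply: leq_trans (hk _); apply: hm.
have h7 : size (f w) <= (4 * size w + 1).+2 ^ l.
  pose proof (size_esize (f w)); have h8 := hfq w.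
  have : q (esize w) <= (4 * size w + 1).+2 ^ l by apply: leq_trans (hl _); apply: hmq.
  by lia.
by rewrite size_rev in hn; rewrite /P; lia.
Qed.

Lemma PF_in_P (f : seq bool -> bool) : PF f -> in_P (fun w => f w).
Proof.
move=> [c [p [hp hm hc]]]; have [k hk] := hp.
pose P n := 1 + (6 * n + 1 + ((8 * n + 3) + (8 * n + 3))) + (4 * n + 1).+2 ^ k.
apply: (@decider_in_P (Seq read_input c) f P) => [|w]; first by rewrite /P; poly_tac.
pose proof (execle_read_input w) as h1.
pose proof (hc w [::]) as h2; rewrite !cats0 in h2.
have [n hn he] := execle_seq h1 h2.
refine (ex_intro _ n (ex_intro _ _ (And3 _ he _))); last by case: (f w); eexists.
pose proof (esize_bits w) as hw.
have h6 : p (esize w) <= (4 * size w + 1).+2 ^ k by apply: leq_trans (hk _); apply: hm.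
by rewrite /P; lia.
Qed.

(** * A library of polynomial-time functions *)

Section Projections.

Context {E A B : Type} {eE : encodable E} {eA : encodable A} {eB : encodable B}.

Lemma PF_pfst (f : E -> A * B) : PF f -> PF (fun e => (f e).1).
Proof. exact: (PF_comp PF_fst). Qed.

Lemma PF_psnd (f : E -> A * B) : PF f -> PF (fun e => (f e).2).
Proof. exact: (PF_comp PF_snd). Qed.

(** A program only sees encodings, so a value may change its type for free. *)
Lemma PF_enc_eq (A' : Type) {eA' : encodable A'} (f : E -> A) (g : E -> A') :
  (forall e, enc (f e) = enc (g e)) -> PF f -> PF g.
Proof. by move=> hfg [c [p [hp hm hc]]]; exists c, p; split=> // e u; rewrite -hfg. Qed.

End Projections.

Ltac pf_step :=
  lazymatch goal with
  | |- @PF _ _ _ _ (fun e => e) => exact: PF_id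
  | |- @PF _ _ _ _ (fun _ => ?c) => exact: PF_cst
  | |- @PF _ _ _ _ fst => exact: PF_fst
  | |- @PF _ _ _ _ snd => exact: PF_snd
  | |- @PF _ _ _ _ (fun e => (@?f e, @?g e)) => apply: PF_pair
  | |- @PF _ _ _ _ (fun e => (@?f e).1) => apply: PF_pfst
  | |- @PF _ _ _ _ (fun e => (@?f e).2) => apply: PF_psnd
  | |- @PF _ _ _ _ (fun e => if _ then _ else _) => apply: PF_if
  | |- @PF _ _ _ _ (fun e => @?f e :: @?g e) => apply: PF_cons
  | |- @PF _ _ _ _ (fun e => S (@?f e)) => apply: PF_succ
  end.

Ltac pf := repeat first [ assumption | pf_step ].

Section Folds.

Context {E A B : Type} {eE : encodable E} {eA : encodable A} {eB : encodable B}.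

Lemma PF_foldl_bounded (g : E -> B -> A -> B) (l : E -> seq A) (s : E -> B) q :
    PF (fun p : E * B * A => g p.1.1 p.1.2 p.2) -> PF l -> PF s -> poly q ->
    (forall e l1 l2, l e = l1 ++ l2 -> esize (foldl (g e) (s e) l1) <= q (esize e)) ->
  PF (fun e => foldl (g e) (s e) (l e)).
Proof.
move=> hg hl hs hq hb.
(* The accumulator carries the parameter [e], which the step function of [PF_fold] cannot see
   otherwise. *)
pose g' (p : E * B) x := (p.1, g p.1 p.2 x).
have hfold e l1 s1 : foldl g' (e, s1) l1 = (e, foldl (g e) s1 l1).
  by elim: l1 s1 => //= x l1 IH s1; rewrite IH.
apply: (PF_eq (f := fun e => (foldl g' (e, s e) (l e)).2)) => [e|].
  by rewrite hfold.
apply: PF_psnd; apply: (@PF_fold _ _ _ _ _ _ g' l (fun e => (e, s e)) (fun n => n + q n + 1)).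
- apply: PF_pair; first by pf.
  apply: (PF_comp (f := fun p : A * (E * B) => (p.2, p.1)) hg); pf.
- by [].
- by pf.
- by poly_tac.
- by move=> e l1 l2 hl12; rewrite hfold esize_pair; have := hb _ _ _ hl12; lia.
Qed.

Lemma esize_catl (s t : seq A) : esize s <= esize (s ++ t).
Proof. by pose proof (esize_cat s t); pose proof (esize_gt0 t); lia. Qed.

(** Growth by an additive amount that does not depend on the accumulator sums up to a polynomial
    over the list. *)
Lemma PF_foldl (g : E -> B -> A -> B) (l : E -> seq A) (s : E -> B) r :
    PF (fun p : E * B * A => g p.1.1 p.1.2 p.2) -> PF l -> PF s ->
    poly r -> {homo r : m n / m <= n} ->
    (forall e b x, esize (g e b x) <= esize b + r (esize e + esize x)) ->
  PF (fun e => foldl (g e) (s e) (l e)).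
Proof.
move=> hg hl hs hr hmr hb.
have [ql [hql _ hlq]] := PF_esize hl; have [qs [hqs _ hsq]] := PF_esize hs.
have [k hk] := hr.
apply: (@PF_foldl_bounded g l s (fun n => qs n + ql n * (n + ql n).+2 ^ k)) => //.
  by poly_tac.
move=> e l1 l2 hl12; have hl1 := hlq e; have hs1 := hsq e.
set n := esize e in hl1 hs1 *.
have hle : esize l1 <= ql n by apply: leq_trans hl1; rewrite hl12; apply: esize_catl.
have h1 : forall b, esize (foldl (g e) b l1) <= esize b + size l1 * (n + ql n).+2 ^ k.
  elim: l1 hle {hl12} => [|x l1 IH] hle b /=; first by lia.
  rewrite esize_cons in hle.
  apply: leq_trans (IH _ _) _; first by lia.
  have h2 : r (esize e + esize x) <= (n + ql n).+2 ^ k.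
    by apply: leq_trans (hk _); apply: hmr; rewrite -/n; lia.
  by rewrite mulSn; have := hb e b x; lia.
apply: leq_trans (h1 _) _; apply: leq_add => //; apply: leq_mul => //.
by pose proof (size_esize l1); lia.
Qed.

End Folds.

Section Lists.

Context {E A : Type} {eE : encodable E} {eA : encodable A}.

Lemma PF_catrev (s t : E -> seq A) : PF s -> PF t -> PF (fun e => catrev (s e) (t e)).
Proof.
move=> hs ht.
apply: (PF_eq (f := fun e => foldl (fun acc x => x :: acc) (t e) (s e))) => [e|].
  by elim: (s e) (t e) => //= x l IH y; rewrite IH.
apply: (@PF_foldl _ _ _ _ _ _ (fun _ acc x => x :: acc) s t S) => //; [by pf| |].
  by apply: (poly_le (q := fun n => n + 1)) => [n|]; [lia | poly_tac].
by move=> e b x; rewrite esize_cons; lia.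
Qed.

Lemma PF_rev (s : E -> seq A) : PF s -> PF (fun e => rev (s e)).
Proof. by move=> hs; apply: PF_catrev hs (PF_cst [::]). Qed.

End Lists.

Section Map.

Context {E A B : Type} {eE : encodable E} {eA : encodable A} {eB : encodable B}.

Lemma PF_map (f : E -> A -> B) (s : E -> seq A) :
  PF (fun p : E * A => f p.1 p.2) -> PF s -> PF (fun e => [seq f e x | x <- s e]).
Proof.
move=> hf hs; have [q [hq hmq hfq]] := PF_esize hf.
apply: (PF_eq (f := fun e => rev (foldl (fun acc x => f e x :: acc) [::] (s e)))) => [e|].
  suff h u : foldl (fun acc x => f e x :: acc) u (s e) = catrev (map (f e) (s e)) u by rewrite h -/(rev _) revK.
  by elim: (s e) u => //= x l IH u; rewrite IH.
have [k hk] := hq.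
apply: PF_rev.
apply: (@PF_foldl _ _ _ _ _ _ (fun e acc x => f e x :: acc) s (fun=> [::]) (fun n => (n.+1).+2 ^ k + 1)) => //.
- by apply: PF_cons; [apply: (PF_comp (f := fun p : E * seq B * A => (p.1.1, p.2)) hf) |]; pf.
- exact: PF_cst.
- by apply: (poly_le (q := fun n => (n + 1).+2 ^ k + 1)) => [n|]; [rewrite [n + 1]addn1 | poly_tac].
- move=> m n hmn; rewrite leq_add2r.
  by case: k {hk} => // k; rewrite leq_exp2r.
- move=> e b x; rewrite esize_cons.
  have := hfq (e, x); pose proof (hk (esize (e, x))) as h; rewrite esize_pair /= in h *.
  by lia.
Qed.

End Map.

Section Booleans.

Context {E : Type} {eE : encodable E}.

Lemma PF_negb (a : E -> bool) : PF a -> PF (fun e => ~~ a e).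
Proof. by move=> ha; apply: (PF_eq (f := fun e => if a e then false else true)) => [e|]; pf. Qed.

Lemma PF_andb (a b : E -> bool) : PF a -> PF b -> PF (fun e => a e && b e).
Proof. by move=> ha hb; apply: (PF_eq (f := fun e => if a e then b e else false)) => [e|]; pf. Qed.

Lemma PF_eqb (a b : E -> bool) : PF a -> PF b -> PF (fun e => a e == b e).
Proof.
move=> ha hb.
apply: (PF_eq (f := fun e => if a e then b e else if b e then false else true)) => [e|].
  by case: (a e) (b e) => [] [].
by pf.
Qed.

End Booleans.

Section Sequences.

Context {E A : Type} {eE : encodable E} {eA : encodable A}.

Lemma PF_cat (s t : E -> seq A) : PF s -> PF t -> PF (fun e => s e ++ t e).
Proof.
move=> hs ht; apply: (PF_eq (f := fun e => catrev (rev (s e)) (t e))) => [e|].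
  by rewrite catrevE revK.
by apply: PF_catrev ht; apply: PF_rev.
Qed.

Lemma PF_all (p : E -> A -> bool) (s : E -> seq A) :
  PF (fun q : E * A => p q.1 q.2) -> PF s -> PF (fun e => all (p e) (s e)).
Proof.
move=> hp hs.
apply: (PF_eq (f := fun e => foldl (fun b x => b && p e x) true (s e))) => [e|].
  by rewrite -[RHS]/(true && _); elim: (s e) true => [|x l IH] b /=; rewrite ?andbT // IH andbA.
apply: (@PF_foldl _ _ _ _ _ _ (fun e b x => b && p e x) s (fun=> true) (fun=> 3)) => //.
- apply: PF_andb; first by pf.
  by apply: (PF_comp (f := fun q : E * bool * A => (q.1.1, q.2)) hp); pf.
- exact: PF_cst.
- exact: poly_cst.
- by move=> e b x; pose proof (esize_bool (b && p e x)); lia.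
Qed.

Lemma PF_has (p : E -> A -> bool) (s : E -> seq A) :
  PF (fun q : E * A => p q.1 q.2) -> PF s -> PF (fun e => has (p e) (s e)).
Proof.
move=> hp hs; apply: (PF_eq (f := fun e => ~~ all (fun x => ~~ p e x) (s e))) => [e|].
  by rewrite -has_predC; apply: eq_has => x /=; rewrite negbK.
by apply: PF_negb; apply: (@PF_all (fun e x => ~~ p e x)) => //; apply: PF_negb.
Qed.

Lemma PF_count (p : E -> A -> bool) (s : E -> seq A) :
  PF (fun q : E * A => p q.1 q.2) -> PF s -> PF (fun e => count (p e) (s e)).
Proof.
move=> hp hs.
apply: (PF_eq (f := fun e => foldl (fun n x => if p e x then n.+1 else n) 0 (s e))) => [e|].
  rewrite -[RHS]add0n; elim: (s e) 0 => [|x l IH] n /=; rewrite ?addn0 // IH.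
  by case: (p e x); rewrite ?addSnnS.
apply: (@PF_foldl _ _ _ _ _ _ (fun e n x => if p e x then n.+1 else n) s (fun=> 0) (fun=> 2)) => //.
- apply: PF_if; [|by pf|by pf].
  by apply: (PF_comp (f := fun q : E * nat * A => (q.1.1, q.2)) hp); pf.
- exact: PF_cst.
- exact: poly_cst.
- by move=> e b x; case: (p e x); rewrite !esize_nat; lia.
Qed.

Lemma PF_size (s : E -> seq A) : PF s -> PF (fun e => size (s e)).
Proof.
move=> hs; apply: (PF_eq (f := fun e => count (fun=> true) (s e))) => [e|].
  by rewrite count_predT.
by apply: (@PF_count (fun _ _ => true)) => //; apply: PF_cst.
Qed.

Lemma PF_nilp (s : E -> seq A) : PF s -> PF (fun e => nilp (s e)).
Proof.
move=> hs; apply: (PF_eq (f := fun e => all (fun=> false) (s e))) => [e|].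
  by case: (s e).
by apply: (@PF_all (fun _ _ => false)) => //; apply: PF_cst.
Qed.

Lemma PF_behead (s : E -> seq A) : PF s -> PF (fun e => behead (s e)).
Proof.
apply: PF_comp; apply: (@PF_intro _ _ _ _ _ (Case sD Skip (Push sD false) drop_tree)
  (fun n => 7 * n + 3 + 1)) => [|[|x l] u]; first by poly_tac.
  apply: (@execle_leq _ _ 2); last by rewrite esize_nil.
  by apply: (@execle_case _ _ _ _ _ false u) => //; apply: execle_push.
rewrite addn1; apply: (@execle_case _ _ _ _ _ true (code (enc x) ++ code (enc l) ++ u)).
  by rewrite /= -catA.
by apply: execle_leq (execle_drop_tree _ _) _; rewrite esize_cons /esize; lia.
Qed.

Lemma PF_head (x0 : A) (s : E -> seq A) : PF s -> PF (fun e => head x0 (s e)).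
Proof.
move=> hs; pose g (p : bool * A) x := if p.1 then p else (true, x).
apply: (PF_eq (f := fun e => (foldl g (false, x0) (s e)).2)) => [e|].
  case: (s e) => // x l /=; rewrite /g /=.
  by elim: l => //= y l ->.
apply: PF_psnd; apply: (@PF_foldl _ _ _ _ _ _ (fun _ => g) s (fun=> (false, x0)) (fun n => n + 4)) => //.
- by rewrite /g; pf.
- exact: PF_cst.
- by poly_tac.
- by move=> m n; rewrite leq_add2r.
- move=> e b x; rewrite /g; case: ifP => _; first by lia.
  by rewrite !esize_pair; pose proof (esize_bool true); lia.
Qed.

End Sequences.

Section Naturals.

Context {E A : Type} {eE : encodable E} {eA : encodable A}.

Lemma PF_nseq (x : E -> A) (n : E -> nat) : PF x -> PF n -> PF (fun e => nseq (n e) (x e)).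
Proof.
move=> hx hn.
have h : PF (fun e => nseq (n e) false).
  by apply: PF_enc_eq hn => e; elim: (n e) => //= m ->.
apply: (PF_eq (f := fun e => [seq x e | _ <- nseq (n e) false])) => [e|].
  by rewrite map_nseq.
by apply: (@PF_map _ _ _ _ _ _ (fun e _ => x e)) h; apply: (PF_comp hx); apply: PF_fst.
Qed.

End Naturals.

Section Flatten.

Context {E A : Type} {eE : encodable E} {eA : encodable A}.

Lemma PF_flatten (s : E -> seq (seq A)) : PF s -> PF (fun e => flatten (s e)).
Proof.
move=> hs; apply: (PF_eq (f := fun e => foldl cat [::] (s e))) => [e|].
  by rewrite -[RHS]/([::] ++ _); elim: (s e) [::] => [|x l IH] b /=; rewrite ?cats0 // IH catA.
apply: (@PF_foldl _ _ _ _ _ _ (fun _ => cat) s (fun=> [::]) id) => //.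
- by apply: PF_cat; pf.
- exact: PF_cst.
- by poly_tac.
- by move=> e b x; pose proof (esize_cat b x); lia.
Qed.

Lemma PF_nth (x0 : A) (s : E -> seq A) (n : E -> nat) :
  PF s -> PF n -> PF (fun e => nth x0 (s e) (n e)).
Proof.
move=> hs hn; apply: (PF_eq (f := fun e =>
  head x0 (foldl (fun l _ => behead l) (s e) (nseq (n e) false)))) => [e|].
  by elim: (n e) (s e) => [|m IH] [|x l] //=; rewrite IH ?nth_nil.
apply: PF_head; apply: (@PF_foldl _ _ _ _ _ _ (fun _ l _ => behead l) _ s (fun=> 1)) => //.
- by apply: PF_behead; pf.
- by apply: PF_nseq; pf.
- exact: poly_cst.
- by move=> e [|x l] b; rewrite /= ?esize_cons; lia.
Qed.

End Flatten.

Section Arithmetic.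

Context {E : Type} {eE : encodable E}.

Lemma PF_addn (m n : E -> nat) : PF m -> PF n -> PF (fun e => m e + n e).
Proof.
move=> hm hn; apply: (PF_eq (f := fun e => size (nseq (m e) false ++ nseq (n e) false))) => [e|].
  by rewrite size_cat !size_nseq.
by apply: PF_size; apply: PF_cat; apply: PF_nseq; pf.
Qed.

Lemma PF_muln (m n : E -> nat) : PF m -> PF n -> PF (fun e => m e * n e).
Proof.
move=> hm hn; apply: (PF_eq (f := fun e => size (flatten (nseq (m e) (nseq (n e) false))))) => [e|].
  by rewrite size_flatten /shape map_nseq size_nseq sumn_nseq mulnC.
by apply: PF_size; apply: PF_flatten; apply: PF_nseq; [apply: PF_nseq; pf|].
Qed.

Lemma PF_expn (n : E -> nat) k : PF n -> PF (fun e => n e ^ k).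
Proof.
move=> hn; elim: k => [|k IH]; first exact: PF_cst.
apply: (PF_eq (f := fun e => n e * n e ^ k)) => [e|]; first by rewrite expnS.
exact: PF_muln.
Qed.

Lemma PF_poly_bound k (n : E -> nat) : PF n -> PF (fun e => poly_bound k (n e)).
Proof.
move=> hn; rewrite /poly_bound; apply: PF_addn; last exact: PF_cst.
by apply: PF_muln; [apply: PF_cst | apply: PF_expn].
Qed.

(** The length of the accumulator serves as the counter. Each step adds an element as large as that
    length, so the size of the accumulator has to be bounded directly. *)
Lemma PF_iota (n : E -> nat) : PF n -> PF (fun e => iota 0 (n e)).
Proof.
move=> hn; pose g (acc : seq nat) (_ : bool) := size acc :: acc.
have hg m : foldl g [::] (nseq m false) = rev (iota 0 m).
  elim: m => // m IH; rewrite -addn1 nseqD foldl_cat IH /= /g size_rev size_iota.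
  by rewrite iotaD rev_cat.
apply: (PF_eq (f := fun e => rev (foldl g [::] (nseq (n e) false)))) => [e|].
  by rewrite hg revK.
apply: PF_rev; have [q [hq _ hnq]] := PF_esize hn.
apply: (@PF_foldl_bounded _ _ _ _ _ _ (fun _ => g) _ (fun=> [::]) (fun n => q n * (2 * q n + 2) + 1)) => //.
- by rewrite /g; apply: PF_cons; [apply: PF_size|]; pf.
- by apply: PF_nseq; pf.
- exact: PF_cst.
- by poly_tac.
- move=> e l1 l2 hl12.
  have hs : size l1 <= n e.
    by have := congr1 size hl12; rewrite size_nseq size_cat; lia.
  have -> : l1 = nseq (size l1) false.
    have : all (pred1 false) l1.
      have : all (pred1 false) (nseq (n e) false) by rewrite all_nseq orbT.
      by rewrite hl12 all_cat => /andP[].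
    by move/all_pred1P.
  have hi m : esize (rev (iota 0 m)) <= m * (2 * m + 2) + 1.
    elim: m => // m IH; rewrite -addn1 iotaD rev_cat esize_cons esize_nat.
    by nia.
  rewrite hg; apply: leq_trans (hi _) _; rewrite leq_add2r.
  have := hnq e; rewrite esize_nat => hq'.
  by apply: leq_mul; lia.
Qed.

End Arithmetic.

Section Equality.

Context {E A : Type} {eE : encodable E}.

Lemma PF_eq_bits (s t : E -> seq bool) : PF s -> PF t -> PF (fun e => s e == t e).
Proof.
move=> hs ht.
pose g (p : seq bool * bool) b := (behead p.1, [&& p.2, ~~ nilp p.1 & head false p.1 == b]).
pose f e := let p := foldl g (t e, true) (s e) in p.2 && nilp p.1.
apply: (PF_eq (f := f)) => [e|].
  rewrite /f -[RHS]/(true && _); elim: (s e) (t e) true => [|b l IH] [|c u] d //=.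
  - by rewrite !IH /= !andbF.
  - by rewrite IH eqseq_cons eq_sym -andbA.
have h : PF (fun e => foldl g (t e, true) (s e)).
  apply: (@PF_foldl _ _ _ _ _ _ (fun _ => g) s (fun e => (t e, true)) (fun=> 3)) => //.
  - rewrite /g; apply: PF_pair; first by apply: PF_behead; pf.
    apply: PF_andb; first by pf.
    apply: PF_andb; first by apply: PF_negb; apply: PF_nilp; pf.
    by apply: PF_eqb; [apply: PF_head|]; pf.
  - by pf.
  - exact: poly_cst.
  - move=> e [l c] b; rewrite /g /= !esize_pair.
    pose proof (esize_bool [&& c, ~~ nilp l & head false l == b]).
    by case: l H => [|x l] H; rewrite ?esize_cons /= in H *; lia.
by rewrite /f; apply: PF_andb; [|apply: PF_nilp]; pf.
Qed.

End Equality.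

Section DecidableEquality.

Context {E : Type} {A : eqType} {eE : encodable E} {eA : encodable A}.

Lemma PF_eqop (a b : E -> A) : PF a -> PF b -> PF (fun e => a e == b e).
Proof.
move=> ha hb; apply: (PF_eq (f := fun e => code (enc (a e)) == code (enc (b e)))) => [e|].
  by apply/eqP/eqP => [/code_inj h|-> //]; apply: enc_inj h.
by apply: PF_eq_bits; apply: (PF_comp PF_code).
Qed.

End DecidableEquality.

Section Membership.

Context {E : Type} {A : eqType} {eE : encodable E} {eA : encodable A}.

Lemma PF_mem (a : E -> A) (s : E -> seq A) : PF a -> PF s -> PF (fun e => a e \in s e).
Proof.
move=> ha hs; apply: (PF_eq (f := fun e => has (fun x => x == a e) (s e))) => [e|].
  by rewrite -has_pred1; apply: eq_has => x.
apply: (@PF_has _ _ _ _ (fun e x => x == a e)) => //; apply: PF_eqop; first by pf.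
by apply: (PF_comp ha); apply: PF_fst.
Qed.

End Membership.

Section Undup.

Context {E : Type} {A : eqType} {eE : encodable E} {eA : encodable A}.

Lemma PF_undup (s : E -> seq A) : PF s -> PF (fun e => undup (s e)).
Proof.
move=> hs; pose g (acc : seq A) x := if x \in acc then acc else x :: acc.
apply: (PF_eq (f := fun e => foldl g [::] (rev (s e)))) => [e|].
  by rewrite foldl_rev; elim: (s e) => //= x l ->; rewrite /g mem_undup.
apply: (@PF_foldl _ _ _ _ _ _ (fun _ => g) _ (fun=> [::]) S) => //.
- by rewrite /g; apply: PF_if; [apply: PF_mem| |]; pf.
- exact: PF_rev.
- exact: PF_cst.
- by apply: (poly_le (q := fun n => n + 1)) => [n|]; [lia | poly_tac].
- by move=> e b x; rewrite /g; case: ifP => _; rewrite ?esize_cons; lia.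
Qed.

End Undup.

Section Sums.

Context {A B : Type} {eA : encodable A} {eB : encodable B}.

Definition enc_sum (x : A + B) : tree :=
  match x with inl a => enc (false, a) | inr b => enc (true, b) end.

Lemma enc_sum_inj : injective enc_sum.
Proof. by move=> [a|b] [a'|b'] //= [] h; rewrite (enc_inj h). Qed.

#[export] Instance encodable_sum : encodable (A + B) := {| enc_inj := enc_sum_inj |}.

Context {E : Type} {eE : encodable E}.

Lemma PF_inl (f : E -> A) : PF f -> PF (fun e => inl (f e) : A + B).
Proof. by move=> hf; apply: (PF_enc_eq (f := fun e => (false, f e))) => //; pf. Qed.

Lemma PF_inr (f : E -> B) : PF f -> PF (fun e => inr (f e) : A + B).
Proof. by move=> hf; apply: (PF_enc_eq (f := fun e => (true, f e))) => //; pf. Qed.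

End Sums.

(** * Formulas over arbitrary variables *)

Definition glit (T : Type) := (bool * T)%type.
Definition gclause (T : Type) := (glit T * glit T * glit T)%type.

Section Formulas.

Variable T : Type.

Definition glits (c : gclause T) : seq (glit T) := [:: c.1.1; c.1.2; c.2].
Definition gtrue (val : T -> bool) (l : glit T) : bool := val l.2 == l.1.
Definition gntrue (val : T -> bool) (c : gclause T) : nat := count (gtrue val) (glits c).
Definition flits (F : seq (gclause T)) : seq (glit T) := flatten (map glits F).

End Formulas.

Section Renaming.

Variables (T U : Type) (phi : T -> U).

Definition lmap (l : glit T) : glit U := (l.1, phi l.2).
Definition cmap (c : gclause T) : gclause U := (lmap c.1.1, lmap c.1.2, lmap c.2).

Lemma glits_cmap c : glits (cmap c) = map lmap (glits c).
Proof. by []. Qed.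

Lemma flits_cmap F : flits (map cmap F) = map lmap (flits F).
Proof. by elim: F => //= c F IH; rewrite /flits /= in IH *; rewrite IH. Qed.

Lemma gntrue_cmap (val : U -> bool) c : gntrue val (cmap c) = gntrue (val \o phi) c.
Proof. by rewrite /gntrue glits_cmap count_map. Qed.

End Renaming.

Lemma clause_litsE (c : clause) : clause_lits c = glits c.
Proof. by case: c => [[]]. Qed.

Lemma ntrueE val (c : clause) : ntrue val c = gntrue val c.
Proof. by rewrite /ntrue clause_litsE. Qed.

Lemma occurrencesE (F : formula) v : occurrences F v = count (fun l => l.2 == v) (flits F).
Proof. by rewrite /occurrences /flits (eq_map clause_litsE). Qed.

Lemma eq_gntrue T (v1 v2 : T -> bool) c :
  (forall l, l = c.1.1 \/ l = c.1.2 \/ l = c.2 -> v1 l.2 = v2 l.2) -> gntrue v1 c = gntrue v2 c.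
Proof. by move=> h; rewrite /gntrue /gtrue /= !h; auto. Qed.

Lemma mem_flits (T : eqType) (F : seq (gclause T)) c l :
  c \in F -> l \in glits c -> l \in flits F.
Proof. by move=> hc hl; apply/flatten_mapP; exists c. Qed.

(** * Parsing of encoded formulas *)

(** A literal, the first component of [pair_enc] and a name in the witness all have this format, so
    one parser serves for all three. *)
Definition enc_block (s : seq bool) : seq bool := data_bits s ++ [:: false; false].
Definition enc_blocks (bs : seq (seq bool)) : seq bool := flatten (map enc_block bs).

Definition block_state := (seq bool * seq bool * seq (seq bool))%type.

(** The state holds the first bit of an unfinished pair, the current block and the finished blocks.
    A pair that begins with false closes the block, whatever its second bit. *)
Definition block_step (p : block_state) (b : bool) : block_state :=
  if nilp p.1.1 then ([:: b], p.1.2, p.2)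
  else if head false p.1.1 then ([::], p.1.2 ++ [:: b], p.2)
  else ([::], [::], p.2 ++ [:: p.1.2]).

Definition blocks (s : seq bool) : seq (seq bool) :=
  (foldl block_step ([::], [::], [::]) s).2.

Lemma foldl_block_step cur acc s r :
  foldl block_step ([::], cur, acc) (enc_block s ++ r) =
  foldl block_step ([::], [::], acc ++ [:: cur ++ s]) r.
Proof.
by elim: s cur => [|b s IH] cur; rewrite /= /block_step /= ?cats0 // IH -catA.
Qed.

Lemma foldl_block_acc p cur acc acc' r :
  (foldl block_step (p, cur, acc ++ acc') r).2 =
  acc ++ (foldl block_step (p, cur, acc') r).2.
Proof.
elim: r p cur acc' => //= b r IH p cur acc'; rewrite /block_step /=.
by case: (nilp p) => //; case: (head false p); rewrite // -catA IH.
Qed.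

(** Soundness needs this: the input word is recovered even if the witness after it is garbage. *)
Lemma blocks_enc_block s r : exists bs, blocks (enc_block s ++ r) = s :: bs.
Proof.
rewrite /blocks foldl_block_step -[[::] ++ [:: s]]cats0 foldl_block_acc.
by eexists.
Qed.

Lemma blocks_enc_blocks bs : blocks (enc_blocks bs) = bs.
Proof.
suff h acc : (foldl block_step ([::], [::], acc) (enc_blocks bs)).2 = acc ++ bs.
  by rewrite /blocks h.
elim: bs acc => [|s bs IH] acc; first by rewrite cats0.
rewrite /enc_blocks /= -/(enc_blocks bs).
by rewrite foldl_block_step IH -catA.
Qed.

Section Triples.

Variables (T : Type) (x0 : T).

Definition triple_step (p : seq T * seq (T * T * T)) (x : T) :=
  if nilp (behead p.1) then (p.1 ++ [:: x], p.2)
  else ([::], p.2 ++ [:: (head x0 p.1, head x0 (behead p.1), x)]).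

Definition triples (s : seq T) : seq (T * T * T) := (foldl triple_step ([::], [::]) s).2.

Lemma triples_flatten ts :
  triples (flatten (map (fun t : T * T * T => [:: t.1.1; t.1.2; t.2]) ts)) = ts.
Proof.
set fl := fun t : T * T * T => _.
suff h acc : (foldl triple_step ([::], acc) (flatten (map fl ts))).2 = acc ++ ts.
  by rewrite /triples h.
elim: ts acc => [|[[a b] c] ts IH] acc /=; first by rewrite cats0.
by rewrite /triple_step /= IH -catA.
Qed.

End Triples.

Definition block_lit (s : seq bool) : glit (seq bool) := (head false s, behead s).
Definition lit_block (l : glit (seq bool)) : seq bool := l.1 :: l.2.

Definition parse (w : seq bool) : seq (gclause (seq bool)) :=
  [seq (block_lit t.1.1, block_lit t.1.2, block_lit t.2) | t <- triples [::] (blocks w)].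

Definition unparse (F : seq (gclause (seq bool))) : seq bool :=
  enc_blocks (map lit_block (flits F)).

Lemma unparseK F : parse (unparse F) = F.
Proof.
rewrite /parse /unparse blocks_enc_blocks.
have -> : map lit_block (flits F) = flatten (map (fun t => [:: t.1.1; t.1.2; t.2])
    [seq (lit_block c.1.1, lit_block c.1.2, lit_block c.2) | c <- F]).
  by elim: F => //= c F; rewrite /flits /= => ->.
rewrite triples_flatten -map_comp -[RHS]map_id; apply: eq_map.
by case=> [[[? ?] [? ?]] [? ?]].
Qed.

Lemma enc_formulaE F : enc_formula F = unparse (map (cmap nat_bits) F).
Proof.
elim: F => //= c F IH; rewrite /enc_formula /= -/(enc_formula F) IH clause_litsE.
rewrite /unparse -![flits (_ :: _)]/(glits _ ++ flits _) map_cat /enc_blocks map_cat flatten_cat.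
by rewrite glits_cmap -!map_comp.
Qed.

(** * Names of variables *)

Fixpoint bits_pos (s : seq bool) : positive :=
  match s with
  | [::] => xH
  | true :: s' => xI (bits_pos s')
  | false :: s' => xO (bits_pos s')
  end.

(** [bits_pos] restores the leading 1, and the predecessor undoes the successor in [nat_bits]. *)
Definition bits_nat (s : seq bool) : nat := (Pos.to_nat (bits_pos s)).-1.

Lemma bits_natK : cancel bits_nat nat_bits.
Proof.
move=> s; rewrite /nat_bits /bits_nat.
have -> : Pos.of_succ_nat (Pos.to_nat (bits_pos s)).-1 = bits_pos s.
  by apply: Pnat.Pos2Nat.inj; rewrite Pnat.SuccNat2Pos.id_succ; have := Pnat.Pos2Nat.is_pos (bits_pos s); lia.
by elim: s => //= -[] s /= ->.
Qed.

Lemma pos_bits_inj : injective pos_bits.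
Proof. by elim=> [p IH|p IH|] [q|q|] //= [/IH ->]. Qed.

Lemma nat_bits_inj : injective nat_bits.
Proof. by move=> m n /pos_bits_inj /Pnat.SuccNat2Pos.inj. Qed.

(** * Membership in NP *)

(** Comparing all pairs of clauses avoids naming the common number; membership in [iota 0 5]
    expresses [<= 4] through a test already known to be polynomial. *)
Definition check (w : seq bool) (names : seq (seq bool)) : bool :=
  [&& unparse (parse w) == w,
      all (fun c => all (fun d => gntrue (mem names) c == gntrue (mem names) d) (parse w)) (parse w)
    & all (fun l => count (fun l' => l'.2 == l.2) (flits (parse w)) \in iota 0 5) (flits (parse w))].

Definition verify (z : seq bool) : bool := check (head [::] (blocks z)) (behead (blocks z)).

Lemma check_sound w names : check w names -> ATS_3CNF4 w.
Proof.
case/and3P=> /eqP hw hsame hocc; set F := parse w in hw hsame hocc.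
pose G : formula := map (cmap bits_nat) F.
have hG : map (cmap nat_bits) G = F.
  rewrite -map_comp -[RHS]map_id; apply: eq_map => -[[[? ?] [? ?]] [? ?]].
  by rewrite /= /cmap /lmap /= !bits_natK.
exists G; split; first by rewrite enc_formulaE hG.
split.
  move=> v; rewrite occurrencesE flits_cmap count_map.
  have [/hasP[l hl /= /eqP hv]|/hasPn hn] := boolP (has (fun l => bits_nat l.2 == v) (flits F)).
    have := allP hocc l hl; rewrite mem_iota /= ltnS; apply: leq_trans.
    by apply: sub_count => l' /= /eqP h; apply/eqP/(can_inj bits_natK); rewrite h.
  rewrite (@eq_in_count _ _ pred0) ?count_pred0 // => l /hn /= h.
  exact: negbTE.
exists (fun n => nat_bits n \in names).
exists (if F is c :: _ then gntrue (mem names) c else 0).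
apply/allP => _ /mapP[c hc ->]; rewrite ntrueE gntrue_cmap.
have -> : gntrue ((fun n => nat_bits n \in names) \o bits_nat) c = gntrue (mem names) c.
  by apply: eq_gntrue => l _ /=; rewrite bits_natK.
case: F hsame hc {hG hw hocc G} => // c0 F /andP[/allP h _] hc.
by rewrite eq_sym; apply: h.
Qed.

(** Each listed name stems from its own literal occurrence in [w], whose block also contains the
    sign and is therefore longer. *)
Lemma check_complete w : ATS_3CNF4 w ->
  exists2 names, size (enc_blocks names) <= size w & check w names.
Proof.
move=> [F [-> [hocc [val [k hk]]]]]; set Fb := map (cmap nat_bits) F.
pose names := [seq nat_bits l.2 | l <- flits F & val l.2].
exists names.
  rewrite enc_formulaE /unparse flits_cmap /names -/Fb -map_comp.
  elim: (flits F) => //= l s IH; rewrite /enc_blocks /= in IH *.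
  by case: ifP => _ /=; rewrite !size_cat /=; lia.
rewrite /check enc_formulaE -/Fb unparseK eqxx andTb; apply/andP; split.
  have hval c : c \in F -> gntrue (mem names) (cmap nat_bits c) = k.
    move=> hc; rewrite gntrue_cmap.
    have := allP hk c hc; rewrite ntrueE => /eqP <-; apply: eq_gntrue => l hl /=.
    have {}hl : l \in flits F.
      by apply: (mem_flits hc); rewrite !inE; case: hl => [->|[->|->]]; rewrite eqxx ?orbT.
    apply/mapP/idP => [[l' + /nat_bits_inj e]|hv]; last by exists l; rewrite ?mem_filter ?hv.
    by rewrite mem_filter e => /andP[].
  by apply/allP => _ /mapP[c hc ->]; apply/allP => _ /mapP[d hd ->]; rewrite !hval.
apply/allP => l' hl'; rewrite mem_iota /= ltnS.
move: hl'; rewrite flits_cmap => /mapP[l hl ->]; rewrite count_map.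
apply: leq_trans (hocc l.2); rewrite occurrencesE; apply: sub_count => l1 /= /eqP h.
exact/eqP/nat_bits_inj.
Qed.

(** * The verifier runs in polynomial time *)

Section VerifierPF.

Context {E : Type} {eE : encodable E}.

Lemma PF_blocks (s : E -> seq bool) : PF s -> PF (fun e => blocks (s e)).
Proof.
move=> hs; apply: PF_psnd.
apply: (@PF_foldl _ _ _ _ _ _ (fun _ => block_step) s (fun=> ([::], [::], [::])) (fun=> 10)) => //.
- rewrite /block_step; apply: PF_if; first by apply: PF_nilp; pf.
    by pf.
  apply: PF_if; first by apply: PF_head; pf.
    by apply: PF_pair; [apply: PF_pair; [|apply: PF_cat]|]; pf.
  by apply: PF_pair; [|apply: PF_cat]; pf.
- exact: PF_cst.
- exact: poly_cst.
- move=> e [[p cur] acc] b; rewrite /block_step /=.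
  pose proof (esize_bool b); pose proof (esize_gt0 p).
  case: ifP => _; first by rewrite !esize_pair esize_cons !esize_nil; lia.
  case: ifP => _; rewrite !esize_pair ?esize_nil.
    by pose proof (esize_cat cur [:: b]) as h; rewrite esize_cons esize_nil in h; lia.
  by pose proof (esize_cat acc [:: cur]) as h; rewrite esize_cons esize_nil in h; lia.
Qed.

Context {A : Type} {eA : encodable A}.

Lemma PF_triples (x0 : A) (s : E -> seq A) : PF s -> PF (fun e => triples x0 (s e)).
Proof.
move=> hs; apply: PF_psnd.
apply: (@PF_foldl _ _ _ _ _ _ (fun _ => triple_step x0) s (fun=> ([::], [::]))
  (fun n => n + (2 * esize x0 + 10))) => //.
- rewrite /triple_step; apply: PF_if; first by apply: PF_nilp; apply: PF_behead; pf.
    by apply: PF_pair; [apply: PF_cat|]; pf.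
  apply: PF_pair; first by pf.
  apply: PF_cat; first by pf.
  apply: PF_cons; last by pf.
  by apply: PF_pair; [apply: PF_pair; apply: PF_head; [|apply: PF_behead]|]; pf.
- exact: PF_cst.
- by poly_tac.
- by move=> m n h; rewrite leq_add2r.
- move=> e [p acc] b; rewrite /triple_step /=.
  case: ifP => hp; rewrite !esize_pair ?esize_nil.
    by pose proof (esize_cat p [:: b]) as h; rewrite esize_cons esize_nil in h; lia.
  pose proof (esize_cat acc [:: (head x0 p, head x0 (behead p), b)]) as h.
  rewrite esize_cons esize_nil !esize_pair in h.
  case: p hp h => [|x [|y p]] //= _ h; rewrite !esize_cons.
  by lia.
Qed.

Lemma PF_glits (c : E -> gclause A) : PF c -> PF (fun e => glits (c e)).
Proof. by move=> hc; rewrite /glits; pf. Qed.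

End VerifierPF.

Lemma PF_flits E A {eE : encodable E} {eA : encodable A} (F : E -> seq (gclause A)) :
  PF F -> PF (fun e => flits (F e)).
Proof.
move=> hF; apply: PF_flatten; apply: (@PF_map _ _ _ _ _ _ (fun _ c => glits c)) => //.
by apply: PF_glits; pf.
Qed.

Section ParserPF.

Context {E : Type} {eE : encodable E}.

Lemma PF_enc_blocks (s : E -> seq (seq bool)) : PF s -> PF (fun e => enc_blocks (s e)).
Proof.
move=> hs; apply: PF_flatten; apply: (@PF_map _ _ _ _ _ _ (fun _ => enc_block)) => //.
rewrite /enc_block; apply: PF_cat; last by pf.
apply: PF_flatten; apply: (@PF_map _ _ _ _ _ _ (fun _ b => [:: true; b])); by pf.
Qed.

Lemma PF_unparse (F : E -> seq (gclause (seq bool))) : PF F -> PF (fun e => unparse (F e)).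
Proof.
move=> hF; apply: PF_enc_blocks; apply: (@PF_map _ _ _ _ _ _ (fun _ => lit_block)).
  by rewrite /lit_block; pf.
exact: PF_flits.
Qed.

Lemma PF_parse (w : E -> seq bool) : PF w -> PF (fun e => parse (w e)).
Proof.
move=> hw; apply: (@PF_map _ _ _ _ _ _
  (fun _ t => (block_lit t.1.1, block_lit t.1.2, block_lit t.2))).
  have h (f : E * (seq bool * seq bool * seq bool) -> seq bool) :
      PF f -> PF (fun e => block_lit (f e)).
    by move=> hf; rewrite /block_lit; apply: PF_pair; [apply: PF_head | apply: PF_behead].
  by apply: PF_pair; [apply: PF_pair|]; apply: h; pf.
by apply: PF_triples; apply: PF_blocks.
Qed.

Lemma PF_gntrue_mem (Y : E -> seq (seq bool)) (c : E -> gclause (seq bool)) :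
  PF Y -> PF c -> PF (fun e => gntrue (mem (Y e)) (c e)).
Proof.
move=> hY hc; apply: (@PF_count _ _ _ _ (fun e l => gtrue (mem (Y e)) l)).
  rewrite /gtrue; apply: PF_eqb; last by pf.
  by apply: PF_mem; [|apply: (PF_comp hY)]; pf.
exact: PF_glits.
Qed.

End ParserPF.

Lemma PF_check : PF (fun p : seq bool * seq (seq bool) => check p.1 p.2).
Proof.
have hF E (eE : encodable E) (w : E -> seq bool) : PF w -> PF (fun e => parse (w e)).
  exact: PF_parse.
rewrite /check; apply: PF_andb; last apply: PF_andb.
- by apply: PF_eqop; [apply: PF_unparse; apply: hF|]; pf.
- apply: (@PF_all _ _ _ _ (fun p c => all (fun d => gntrue (mem p.2) c == gntrue (mem p.2) d) (parse p.1)));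
    last by apply: hF; pf.
  apply: (@PF_all _ _ _ _ (fun (q : _ * _) d => gntrue (mem q.1.2) q.2 == gntrue (mem q.1.2) d));
    last by apply: hF; pf.
  by apply: PF_eqop; apply: PF_gntrue_mem; pf.
- apply: (@PF_all _ _ _ _ (fun p l => count (fun l' => l'.2 == l.2) (flits (parse p.1)) \in iota 0 5));
    last by apply: PF_flits; apply: hF; pf.
  apply: PF_mem; last by pf.
  apply: (@PF_count _ _ _ _ (fun (q : _ * glit _) l' => l'.2 == q.2.2)); last by apply: PF_flits; apply: hF; pf.
  by apply: PF_eqop; pf.
Qed.

Lemma PF_verify : PF verify.
Proof.
apply: (PF_comp (f := fun z => (head [::] (blocks z), behead (blocks z))) PF_check).
by apply: PF_pair; [apply: PF_head | apply: PF_behead]; apply: PF_blocks; pf.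
Qed.

Theorem ATS_in_NP : in_NP ATS_3CNF4.
Proof.
exists (fun z => verify z); split; first exact: PF_in_P PF_verify.
exists 1 => w; split=> [/check_complete[names hs hc]|[y [_ hv]]].
  exists (enc_blocks names); split; first by rewrite /poly_bound; lia.
  rewrite /verify (_ : pair_enc w _ = enc_blocks (w :: names)) ?blocks_enc_blocks //.
  by rewrite /pair_enc /enc_blocks /= /enc_block -catA.
move: hv; rewrite /verify (_ : pair_enc w y = enc_block w ++ y); last first.
  by rewrite /pair_enc /enc_block -catA.
by have [bs ->] := blocks_enc_block w y; apply: check_sound.
Qed.

(** * From 3-SAT to one-in-three satisfiability *)

Definition sat (T : Type) (C : seq (gclause T)) : Prop :=
  exists val, all (fun c => 0 < gntrue val c) C.

Definition one_sat (T : Type) (C : seq (gclause T)) : Prop :=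
  exists val, all (fun c => gntrue val c == 1) C.

Definition same_sat (T : Type) (C : seq (gclause T)) : Prop :=
  exists val k, all (fun c => gntrue val c == k) C.

Section OneInThree.

Variable V : Type.

(** New variables are named after the clause and not its position: equal clauses share them, which
    is harmless because their gadgets coincide. *)
Definition gvar := (V + gclause V * nat)%type.

Definition old_lit (l : glit V) : glit gvar := (l.1, inl l.2).
Definition old_neg (l : glit V) : glit gvar := (~~ l.1, inl l.2).
Definition new_lit (c : gclause V) (i : nat) : glit gvar := (true, inr (c, i)).

(* Schaefer's gadget: x or y or z holds iff R(~x, a, b), R(y, b, c), R(~z, c, d)
   is solvable in a, b, c, d, where R means that exactly one argument is true. *)
Definition gadget (c : gclause V) : seq (gclause gvar) :=
  [:: (old_neg c.1.1, new_lit c 0, new_lit c 1);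
      (old_lit c.1.2, new_lit c 1, new_lit c 2);
      (old_neg c.2, new_lit c 2, new_lit c 3)].

Definition one_in_three (C : seq (gclause V)) : seq (gclause gvar) :=
  flatten (map gadget C).

Definition gadget_val (val : V -> bool) (u : gvar) : bool :=
  match u with
  | inl v => val v
  | inr (c, i) =>
      let x := gtrue val c.1.1 in let y := gtrue val c.1.2 in let z := gtrue val c.2 in
      nth false [:: x && y; ~~ y && x; ~~ y && ~~ x; z && (x || y)] i
  end.

Lemma all_flatten_map A B (p : pred B) (f : A -> seq B) (s : seq A) :
  all p (flatten (map f s)) = all (fun x => all p (f x)) s.
Proof. by elim: s => //= x s IH; rewrite all_cat IH. Qed.

(** If x, y and z are false, the first clause of the gadget forces a = b = 0, the second c = 1, and
    the third then has both ~z and c. For the other direction [gadget_val] works; truth of the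
    original clause matters only when z is false, where c must be 0. *)
Lemma one_in_threeP C : sat C <-> one_sat (one_in_three C).
Proof.
split=> -[val hC].
  exists (gadget_val val); rewrite all_flatten_map; apply: sub_all hC => c.
  case: c => [[[s1 v1] [s2 v2]] [s3 v3]].
  rewrite /gntrue /gtrue /= /gtrue /=.
  by case: (val v1) (val v2) (val v3) s1 s2 s3 => [] [] [] [] [] [].
exists (fun v => val (inl v)); move: hC; rewrite all_flatten_map; apply: sub_all => c.
case: c => [[[s1 v1] [s2 v2]] [s3 v3]].
rewrite /gntrue /gtrue /=; set c : gclause V := (s1, v1, (s2, v2), (s3, v3)).
move: (val (inr (c, 0))) (val (inr (c, 1))) (val (inr (c, 2))) (val (inr (c, 3))).
move: (val (inl v1)) (val (inl v2)) (val (inl v3)) s1 s2 s3 {c}.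
by do 10!case.
Qed.

End OneInThree.

(** * Bounding the number of occurrences *)

Section BoundedOccurrences.

Variable W : eqType.

(** [inl (w, p)] is copy [p] of [w]; [inr (w, p)] is the variable f of the link from this copy to
    the next. *)
Definition cvar := (W * nat + W * nat)%type.

Definition copy_lit (l : glit W) (p : nat) : glit cvar := (l.1, inl (l.2, p)).

Definition use (c : gclause W) (j : nat) : gclause cvar :=
  (copy_lit c.1.1 (3 * j), copy_lit c.1.2 (3 * j).+1, copy_lit c.2 (3 * j).+2).

(* The second clause has [1 + f] true literals, so the common number is 1 or 2 and
   the first clause then forces the copies [p] and [p.+1] of the variable to agree. *)
Definition link (k : W * nat) : seq (gclause cvar) :=
  let f := inr k : cvar in
  [:: ((true, inl k), (false, inl (k.1, k.2.+1)), (true, f));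
      ((true, f), (true, f), (false, f))].

Variable c0 : gclause W.

Definition uses (D : seq (gclause W)) : seq (gclause cvar) :=
  [seq use (nth c0 D j) j | j <- iota 0 (size D)].

(** Each variable gets a copy at every position, even those held by other variables, so that chains
    have no gaps. [undup] prevents a link from being repeated. *)
Definition keys (D : seq (gclause W)) : seq (W * nat) :=
  [seq (w, p) | w <- undup [seq l.2 | l <- flits D], p <- iota 0 (3 * size D)].

Definition split_vars (D : seq (gclause W)) : seq (gclause cvar) :=
  uses D ++ flatten (map link (keys D)).

Lemma keys_uniq D : uniq (keys D).
Proof. by apply: allpairs_uniq; rewrite ?undup_uniq ?iota_uniq // => -[? ?] [? ?]. Qed.

Lemma flits_cons T (c : gclause T) F : flits (c :: F) = glits c ++ flits F.
Proof. by []. Qed.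

Lemma flits_cat T (F G : seq (gclause T)) : flits (F ++ G) = flits F ++ flits G.
Proof. by rewrite /flits map_cat flatten_cat. Qed.

Definition position (u : cvar) : nat := match u with inl (_, p) | inr (_, p) => p end.

Lemma uses_positions D : [seq position l.2 | l <- flits (uses D)] = iota 0 (3 * size D).
Proof.
suff h m n : [seq position l.2 | l <- flits [seq use (nth c0 D j) j | j <- iota m n]]
    = iota (3 * m) (3 * n) by rewrite /uses h.
elim: n m => [|n IH] m; first by rewrite muln0.
rewrite -[iota m n.+1]/(m :: iota m.+1 n) map_cons flits_cons map_cat IH.
rewrite (_ : 3 * n.+1 = 3 + 3 * n) ?iotaD; last by lia.
by rewrite (_ : 3 * m.+1 = 3 * m + 3) //; lia.
Qed.

Lemma count_uses_copy D w p : count (fun l => l.2 == inl (w, p)) (flits (uses D)) <= 1.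
Proof.
apply: (@leq_trans (count_mem p (iota 0 (3 * size D)))); last first.
  by rewrite count_uniq_mem ?iota_uniq // leq_b1.
rewrite -uses_positions count_map; apply: sub_count => l /= /eqP ->.
by rewrite /= eqxx.
Qed.

Lemma count_uses_false D k : count (fun l => l.2 == inr k) (flits (uses D)) = 0.
Proof. by rewrite /uses; elim: (iota _ _) => //= j s IH; rewrite IH. Qed.

Lemma count_links_copy K w p :
  count (fun l => l.2 == inl (w, p)) (flits (flatten (map link K))) =
  count_mem (w, p) K + count (fun k => (k.1, k.2.+1) == (w, p)) K.
Proof.
elim: K => // k K IH.
rewrite -[flatten _]/(link k ++ flatten (map link K)) flits_cat count_cat IH /=.
by rewrite addn0 !(inj_eq inl_inj) /=; lia.
Qed.

Lemma count_links_false K k0 :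
  count (fun l => l.2 == inr k0) (flits (flatten (map link K))) = 4 * count_mem k0 K.
Proof.
elim: K => // k K IH.
rewrite -[flatten _]/(link k ++ flatten (map link K)) flits_cat count_cat IH /=.
by rewrite !(inj_eq inr_inj) /=; lia.
Qed.

(** A copy occurs at most once in a use, once as left end and once as right end of a link. The
    variable f occurs once in the equation and three times in the clause that governs it. *)
Lemma split_vars_occurrences D u : count (fun l => l.2 == u) (flits (split_vars D)) <= 4.
Proof.
have hK k : count_mem k (keys D) <= 1 by rewrite count_uniq_mem ?keys_uniq // leq_b1.
rewrite flits_cat count_cat; case: u => [[w p]|k]; last first.
  by rewrite count_uses_false count_links_false; have := hK k; lia.
(* A right end at [p] belongs to the key [p.-1]; for [p = 0] there is none, and the bound is merely
   generous. *)
have h : count (fun k => (k.1, k.2.+1) == (w, p)) (keys D) <= count_mem (w, p.-1) (keys D).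
  by apply: sub_count => -[w' p'] /= /eqP[-> <-].
rewrite count_links_copy.
by apply: leq_trans (leq_add (count_uses_copy D w p) (leq_add (hK _) (leq_trans h (hK _)))) _.
Qed.

Lemma gntrue_use val c j :
  gntrue val (use c j) =
  gtrue (fun w => val (inl (w, 3 * j))) c.1.1 + gtrue (fun w => val (inl (w, (3 * j).+1))) c.1.2
  + gtrue (fun w => val (inl (w, (3 * j).+2))) c.2.
Proof. by rewrite /gntrue /= addn0 addnA. Qed.

(** From v + ~v' + f = k = 1 + f the copies agree for both values of f, so complementation can wait
    until the end. *)
Lemma split_varsP D : one_sat D <-> same_sat (split_vars D).
Proof.
split=> [[val hD]|[val [k hk]]].
  exists (fun u => if u is inl (w, _) then val w else false), 1.
  rewrite all_cat all_flatten_map; apply/andP; split; apply/allP.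
    move=> _ /mapP[j + ->]; rewrite mem_iota /= => hj.
    have /allP := hD => /(_ (nth c0 D j)); rewrite mem_nth // => /(_ isT).
    by rewrite gntrue_use /gntrue /= addn0 addnA.
  by move=> -[w p] _ /=; rewrite /gntrue /gtrue /=; case: (val w).
move: hk; rewrite all_cat all_flatten_map => /andP[/allP huse /allP hlink].
have hkey w p : (w, p) \in keys D ->
    k = 1 + val (inr (w, p)) /\ val (inl (w, p)) = val (inl (w, p.+1)).
  move=> /hlink /=; rewrite /gntrue /gtrue /= andbT => /andP[/eqP h1 /eqP h2].
  by move: h1 h2; case: (val (inr _)) (val (inl _)) (val (inl _)) => [] [] [] /= <-.
(* The bounds on [k] come from a link, hence from a literal of [D]; if [D] is empty, [k] is
   arbitrary but nothing has to be shown. *)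
have hcopy l p : l \in flits D -> p < 3 * size D -> 
    (0 < k < 3) && (val (inl (l.2, p)) == val (inl (l.2, 0))).
  move=> hl hp; have hin q : q < 3 * size D -> (l.2, q) \in keys D.
    move=> hq; apply: allpairs_f; last by rewrite mem_iota.
    by rewrite mem_undup map_f.
  apply/andP; split; first by have [-> _] := hkey _ _ (hin _ hp); case: (val _).
  elim: p hp => // p IH hp; have [_ <-] := hkey _ _ (hin p (ltnW hp)).
  exact: IH (ltnW hp).
(* Two true literals out of three become one under complementation. *)
exists (fun w => val (inl (w, 0)) (+) (k == 2)).
apply/allP => c hc; have hj : index c D < size D by rewrite index_mem.
have /huse : use (nth c0 D (index c D)) (index c D) \in uses D.
  by apply: (map_f (fun j => use (nth c0 D j) j)); rewrite mem_iota.
rewrite nth_index // gntrue_use => /eqP.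
have hm l : l \in glits c -> l \in flits D by apply: mem_flits.
have h1 := @hcopy c.1.1 (3 * index c D); have h2 := @hcopy c.1.2 (3 * index c D).+1.
have h3 := @hcopy c.2 (3 * index c D).+2.
rewrite hm ?inE ?eqxx ?orbT //= in h1; rewrite hm ?inE ?eqxx ?orbT //= in h2.
rewrite hm ?inE ?eqxx ?orbT //= in h3.
have {h1}/andP[hk /eqP h1] := h1 isT ltac:(lia).
have {h2}/andP[_ /eqP h2] := h2 isT ltac:(lia).
have {h3}/andP[_ /eqP h3] := h3 isT ltac:(lia).
rewrite /gntrue /gtrue h1 h2 h3 /= addn0.
move: hk; case: k {hlink hkey hcopy huse} => [|[|[|k]]] //= _;
move: (c.1.1.1) (c.1.2.1) (c.2.1) (val _) (val _) (val _); by do 6!case.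
Qed.

End BoundedOccurrences.

(** * Renaming the variables by bit strings *)

Section Naming.

Variables (U : eqType) (eU : encodable U).

Definition name (u : U) : seq bool := code (enc u).

Definition word (G : seq (gclause U)) : seq bool := unparse (map (cmap name) G).

Lemma name_inj : injective name.
Proof. by move=> u v /code_inj h; apply: enc_inj h. Qed.

(** [unparse] and [nat_bits] are injective, so any formula with this encoding is the renamed [G]. *)
Lemma ATS_word G :
    (forall u, count (fun l => l.2 == u) (flits G) <= 4) ->
  ATS_3CNF4 (word G) <-> same_sat G.
Proof.
move=> hocc; pose phi u := bits_nat (name u).
have phi_inj : injective phi by move=> u v /(can_inj bits_natK)/name_inj.
pose F : formula := map (cmap phi) G.
have hF : word G = enc_formula F.
  rewrite enc_formulaE /word /F -map_comp; congr unparse; apply: eq_map => c /=.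
  by rewrite /cmap /lmap /phi /= !bits_natK.
split=> [[F' [hF' [_ [val [k hk]]]]]|[val [k hk]]].
  have {hF'}: F' = F.
    rewrite hF !enc_formulaE in hF'; move/(can_inj unparseK)/esym: hF'.
    apply: inj_map => -[[[a1 a2] [b1 b2]] [d1 d2]] [[[a1' a2'] [b1' b2']] [d1' d2']].
    by rewrite /cmap /lmap /= => -[-> /nat_bits_inj -> -> /nat_bits_inj -> -> /nat_bits_inj ->].
  move=> e; rewrite e all_map in hk; exists (val \o phi), k.
  by apply: sub_all hk => c /=; rewrite ntrueE gntrue_cmap.
exists F; split=> //; split.
  move=> n; rewrite occurrencesE flits_cmap count_map.
  have [/hasP[l hl /= /eqP hn]|/hasPn hn] := boolP (has (fun l => phi l.2 == n) (flits G)).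
    apply: leq_trans (hocc l.2); apply: sub_count => l' /= /eqP h.
    by apply/eqP/phi_inj; rewrite h.
  rewrite (@eq_in_count _ _ pred0) ?count_pred0 // => l /hn /= h.
  exact: negbTE.
(* Not every number is the name of a variable, so the value is found by searching the literals of
   [G]. *)
pose val' n := has (fun l => (phi l.2 == n) && val l.2) (flits G).
exists val', k; rewrite all_map; apply/allP => c hc /=.
rewrite ntrueE gntrue_cmap -(eqP (allP hk c hc)); apply/eqP/eq_gntrue => l hl /=.
have {}hl : l \in flits G.
  by apply: (mem_flits hc); rewrite !inE; case: hl => [->|[->|->]]; rewrite eqxx ?orbT.
apply/hasP/idP => [[l' hl' /andP[/eqP/phi_inj -> //]]|hv].
by exists l => //; rewrite eqxx.
Qed.

End Naming.

(** * The composed reduction from 3-SAT *)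

Section Reduction.

Variables (V : eqType) (eV : encodable V) (v0 : V).

Definition default_clause : gclause (gvar V) :=
  ((true, inl v0), (true, inl v0), (true, inl v0)).

Definition ats_word (C : seq (gclause V)) : seq bool :=
  word _ (split_vars default_clause (one_in_three C)).

Lemma ATS_ats_word C : ATS_3CNF4 (ats_word C) <-> sat C.
Proof.
rewrite one_in_threeP (split_varsP default_clause); apply: ATS_word.
exact: split_vars_occurrences.
Qed.

End Reduction.

Section ReductionPF.

Context {E : Type} {V : eqType} {eE : encodable E} {eV : encodable V}.

Lemma PF_one_in_three (C : E -> seq (gclause V)) : PF C -> PF (fun e => one_in_three (C e)).
Proof.
move=> hC; apply: PF_flatten; apply: (@PF_map _ _ _ _ _ _ (fun _ => @gadget V)) => //.
have hnew i : PF (fun p : E * gclause V => new_lit p.2 i).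
  by rewrite /new_lit; apply: PF_pair; [|apply: PF_inr]; pf.
have hold (l : E * gclause V -> glit V) : PF l -> PF (fun p => old_lit (l p)).
  by move=> hl; rewrite /old_lit; apply: PF_pair; [|apply: PF_inl]; pf.
have hneg (l : E * gclause V -> glit V) : PF l -> PF (fun p => old_neg (l p)).
  by move=> hl; rewrite /old_neg; apply: PF_pair; [apply: PF_negb|apply: PF_inl]; pf.
rewrite /gadget; apply: PF_cons; last apply: PF_cons; last apply: PF_cons; last exact: PF_cst.
- by apply: PF_pair (hnew _); apply: PF_pair (hnew _); apply: hneg; pf.
- by apply: PF_pair (hnew _); apply: PF_pair (hnew _); apply: hold; pf.
- by apply: PF_pair (hnew _); apply: PF_pair (hnew _); apply: hneg; pf.
Qed.

Lemma PF_split_vars (c0 : gclause V) (D : E -> seq (gclause V)) :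
  PF D -> PF (fun e => split_vars c0 (D e)).
Proof.
move=> hD; rewrite /split_vars; apply: PF_cat.
  apply: (@PF_map _ _ _ _ _ _ (fun e j => use (nth c0 (D e) j) j)); last first.
    by apply: PF_iota; apply: PF_size.
  have hc : PF (fun p : E * nat => nth c0 (D p.1) p.2).
    by apply: PF_nth; [apply: (PF_comp hD)|]; pf.
  have h3 : PF (fun p : E * nat => 3 * p.2) by apply: PF_muln; pf.
  have hl (l : E * nat -> glit V) (q : E * nat -> nat) :
      PF l -> PF q -> PF (fun p => copy_lit (l p) (q p)).
    by move=> hl hq; rewrite /copy_lit; apply: PF_pair; [|apply: PF_inl]; pf.
  by rewrite /use; apply: PF_pair; [apply: PF_pair|]; apply: hl; pf.
apply: PF_flatten; apply: (@PF_map _ _ _ _ _ _ (fun _ => @link V)).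
  have hl (b : bool) (k : E * (V * nat) -> V * nat) :
      PF k -> PF (fun p => (b, inl (k p)) : glit (cvar V)).
    by move=> hk; apply: PF_pair; [|apply: PF_inl]; pf.
  have hr (b : bool) (k : E * (V * nat) -> V * nat) :
      PF k -> PF (fun p => (b, inr (k p)) : glit (cvar V)).
    by move=> hk; apply: PF_pair; [|apply: PF_inr]; pf.
  rewrite /link; apply: PF_cons; last apply: PF_cons; last exact: PF_cst.
    by apply: PF_pair; [apply: PF_pair; apply: hl | apply: hr]; pf.
  by apply: PF_pair; [apply: PF_pair|]; apply: hr; pf.
apply: PF_flatten; apply: (@PF_map _ _ _ _ _ _ (fun e w => [seq (w, p) | p <- iota 0 (3 * size (D e))])).
  apply: (@PF_map _ _ _ _ _ _ (fun (q : E * V) p => (q.2, p))); first by pf.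
  apply: PF_iota; apply: PF_muln; first by pf.
  by apply: PF_size; apply: (PF_comp hD); pf.
apply: PF_undup; apply: (@PF_map _ _ _ _ _ _ (fun _ l => l.2)); first by pf.
exact: PF_flits.
Qed.

Lemma PF_word (G : E -> seq (gclause V)) : PF G -> PF (fun e => word eV (G e)).
Proof.
move=> hG; apply: PF_unparse; apply: (@PF_map _ _ _ _ _ _ (fun _ => cmap (name eV))) => //.
have hl (l : E * gclause V -> glit V) : PF l -> PF (fun p => lmap (name eV) (l p)).
  by move=> hl; rewrite /lmap; apply: PF_pair; [|apply: (PF_comp PF_code)]; pf.
by rewrite /cmap; apply: PF_pair; [apply: PF_pair|]; apply: hl; pf.
Qed.

End ReductionPF.

Lemma PF_ats_word E (V : eqType) {eE : encodable E} {eV : encodable V} (v0 : V)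
  (C : E -> seq (gclause V)) : PF C -> PF (fun e => ats_word eV v0 (C e)).
Proof.
move=> hC; apply: (PF_word (V := cvar (gvar V))); apply: PF_split_vars.
exact: PF_one_in_three.
Qed.

(** * The computation tableau *)

Section Tableau.

Variable M : TM.

(* Column 0 of the tableau is a border, marked [None]; column [j.+1] shows tape
   cell [j] together with the state if the head is there. *)
Definition tsym := option ('I_(tm_S M).+3 * option 'I_(tm_Q M).+1).

Definition tcell (c : tconf (state M) (sym M)) (i : nat) : tsym :=
  if i is j.+1 then Some (c.2 j, if c.1.2 == j then Some c.1.1 else None) else None.

(** A halted head counts as one that stays put in its state, in line with the final configurations
    being fixed points. *)
Definition head_out (g : tsym) : option (state M * move) :=
  if g is Some (s, Some q) then
    if tm_halts q then Some (q, MvS) else let: (q', _, m) := tm_delta q s in Some (q', m)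
  else None.

(** A border on the left shows that [y] is cell 0, where a move to the left stays put. In the rows
    of a run at most one of the three symbols holds the head, so the order of the cases has no
    effect there. *)
Definition rule (x y z : tsym) : tsym :=
  if y is Some (s, oq) then
    Some (if oq is Some q then if tm_halts q then s else (tm_delta q s).1.2 else s,
          match head_out x, head_out y, head_out z with
          | Some (q, MvR), _, _ => Some q
          | _, Some (q, MvS), _ => Some q
          | _, Some (q, MvL), _ => if x is None then Some q else None
          | _, _, Some (q, MvL) => Some q
          | _, _, _ => None
          end)
  else None.

Lemma tcell_step c i :
  tcell (tm_tstep c) i.+1 = rule (tcell c i) (tcell c i.+1) (tcell c i.+2).
Proof.
case: c => [[q h] t]; rewrite /tm_tstep /tstep.
pose o := if tm_halts q then (q, t h, MvS) else tm_delta q (t h).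
have hout k : head_out (tcell (q, h, t) k) = if h.+1 == k then Some (o.1.1, o.2) else None.
  case: k => //= k; rewrite eqSS; case: eqP => //= <-; rewrite /o.
  by case: (tm_halts q) => //; case: (tm_delta q (t h)) => [[? ?] ?].
have -> : (if tm_halts q then (q, h, t) else
           let: (q', b, m) := tm_delta q (t h) in (q', shift m h, write t h b))
          = (o.1.1, shift o.2 h, write t h o.1.2).
  rewrite /o; case: ifP => _ /=; first by rewrite write_same.
  by case: (tm_delta q (t h)) => [[? ?] ?].
have hrule x z : rule x (tcell (q, h, t) i.+1) z =
   Some (if h == i then o.1.2 else t i,
         match head_out x, head_out (tcell (q, h, t) i.+1), head_out z with
          | Some (q, MvR), _, _ => Some q
          | _, Some (q, MvS), _ => Some q
          | _, Some (q, MvL), _ => if x is None then Some q else None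
          | _, _, Some (q, MvL) => Some q
          | _, _, _ => None
          end).
  rewrite /rule /= /o; case: (eqVneq h i) => [->|_] //; by case: (tm_halts q).
rewrite hrule !hout [LHS]/= /write eq_sym; congr (Some (_, _)).
rewrite !eqSS; case: o {hout hrule} => [[q' b] m] /=.
case: m; case: i => [|i] /=; rewrite ?eqSS; do ?[case: eqP => //=]; lia.
Qed.

Arguments tcell : simpl never.

(** Numbers in place of symbols give the tableau variables a type independent of [M]. *)
Definition rank (g : tsym) : nat := enum_rank g.

Lemma rank_inj : injective rank.
Proof. by move=> g g' /val_inj/enum_rank_inj. Qed.

Definition tvar := ((nat * nat) * (nat * nat))%type.
Definition cell_var (t i g : nat) : tvar := ((t, i), (g, 0)).
(** This stands for columns [i] and [i.+1] showing [g1] and [g2]. It splits the implication from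
    three neighbours to the next symbol, which has four literals, into two clauses of three. The
    successor keeps it apart from [cell_var]. *)
Definition pair_var (t i g1 g2 : nat) : tvar := ((t, i), (g1, g2.+1)).

Definition pos (v : tvar) : glit tvar := (true, v).
Definition neg (v : tvar) : glit tvar := (false, v).
Definition unit_clause (l : glit tvar) : gclause tvar := (l, l, l).

Definition border : nat := rank None.
Definition bit_cell (b : bool) : nat := rank (Some (sym_of_bool M b, None)).
Definition blank_cell : nat := rank (Some (blank M, None)).
Definition start_cell (b : bool) : nat := rank (Some (sym_of_bool M b, Some (tm_start M))).

Definition input_prefix (w : seq bool) : seq bool := data_bits w ++ [:: false; false].

(** Each column offers three admissible symbols, all equal where the content is fixed. The start
    cell always has a bit to show, because [input_prefix] ends with a marker and is never empty. *)
Definition first_row (w : seq bool) (B : nat) : seq (nat * nat * nat) :=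
  (border, border, border) ::
  (let g := start_cell (head false (input_prefix w)) in (g, g, g)) ::
  [seq (bit_cell b, bit_cell b, bit_cell b) | b <- behead (input_prefix w)] ++
  nseq B (bit_cell false, bit_cell true, blank_cell).

Definition blank3 : nat * nat * nat := (blank_cell, blank_cell, blank_cell).

Definition init_clauses w B N : seq (gclause tvar) :=
  [seq (let o := nth blank3 (first_row w B) i in
        (pos (cell_var 0 i o.1.1), pos (cell_var 0 i o.1.2), pos (cell_var 0 i o.2)))
  | i <- iota 0 N].

(** Blanks propagate to the right, so the guessed cells amount to a word of length at most [B]
    followed by blanks. *)
Definition blank_clauses N : seq (gclause tvar) :=
  [seq (neg (cell_var 0 i blank_cell), neg (cell_var 0 i blank_cell),
        pos (cell_var 0 i.+1 blank_cell)) | i <- iota 0 N].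

Definition border_clauses T : seq (gclause tvar) :=
  [seq unit_clause (pos (cell_var t 0 border)) | t <- iota 0 T.+1].

Definition table : seq ((nat * nat) * (nat * nat)) :=
  [seq ((rank p.1.1, rank p.1.2), (rank p.2, rank (rule p.1.1 p.1.2 p.2)))
  | p <- enum {: (tsym * tsym) * tsym}].

Definition rule_clauses (t i : nat) (r : (nat * nat) * (nat * nat)) : seq (gclause tvar) :=
  let u := pair_var t i r.1.1 r.1.2 in
  [:: (neg (cell_var t i r.1.1), neg (cell_var t i.+1 r.1.2), pos u);
      (neg u, neg (cell_var t i.+2 r.2.1), pos (cell_var t.+1 i.+1 r.2.2))].

Definition step_clauses T N : seq (gclause tvar) :=
  flatten [seq flatten [seq flatten [seq rule_clauses t i r | r <- table] | i <- iota 0 N]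
          | t <- iota 0 T].

Definition bad_cells : seq nat :=
  [seq rank g | g <- enum {: tsym} &
     if g is Some (_, Some q) then q != tm_acc M else false].

Definition final_clauses T N : seq (gclause tvar) :=
  flatten [seq [seq unit_clause (neg (cell_var T i g)) | g <- bad_cells] | i <- iota 0 N].

Definition tableau w T B N : seq (gclause tvar) :=
  init_clauses w B N ++ blank_clauses N ++ border_clauses T ++ step_clauses T N
  ++ final_clauses T N.

Definition accepting w T B : Prop := exists y, size y <= B /\
  (iter T (@tm_tstep M) (tm_tinit M (pair_enc w y))).1.1 = tm_acc M.

Lemma pair_encE w y : pair_enc w y = input_prefix w ++ y.
Proof. by rewrite /input_prefix -catA. Qed.

Lemma size_data_bits w : size (data_bits w) = 2 * size w.
Proof. by elim: w => //= b w IH; rewrite /data_bits /= in IH *; lia. Qed.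

Lemma size_input_prefix w : size (input_prefix w) = 2 * size w + 2.
Proof. by rewrite size_cat size_data_bits. Qed.

Lemma tinit_cell w y j :
  tcell (tm_tinit M (pair_enc w y)) j.+1 =
  Some (nth (blank M) (map (@sym_of_bool M) (input_prefix w ++ y)) j,
        if j == 0 then Some (tm_start M) else None).
Proof. by rewrite -pair_encE /tcell /= eq_sym. Qed.

Lemma first_row_prefix w B j y : j < size (input_prefix w) ->
  let g := rank (tcell (tm_tinit M (pair_enc w y)) j.+1) in
  nth blank3 (first_row w B) j.+1 = (g, g, g).
Proof.
rewrite tinit_cell map_cat nth_cat size_map => hj; rewrite hj (nth_map false) // /first_row.
have hp := size_input_prefix w; case: (input_prefix w) hp hj => [|b s] hp hj; first by rewrite /= in hp; lia.
case: j hj => //= j hj; rewrite nth_cat size_map -ltnS hj.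
by rewrite (nth_map false).
Qed.

Lemma first_row_guess w B m : m < B ->
  nth blank3 (first_row w B) (size (input_prefix w) + m).+1
  = (bit_cell false, bit_cell true, blank_cell).
Proof.
move=> hm; rewrite /first_row; have hp := size_input_prefix w.
case: (input_prefix w) hp => [|b s] hp /=; first by rewrite /= in hp; lia.
by rewrite nth_cat size_map ltnNge leq_addr /= addKn nth_nseq hm.
Qed.

Lemma first_row_blank w B m : nth blank3 (first_row w B) (size (input_prefix w) + B + m).+1 = blank3.
Proof.
rewrite nth_default // /first_row; have hp := size_input_prefix w.
case: (input_prefix w) hp => [|b s] hp /=; first by rewrite /= in hp; lia.
by rewrite size_cat size_map size_nseq; lia.
Qed.

Lemma tinit_blank w y m :
  rank (tcell (tm_tinit M (pair_enc w y)) (size (input_prefix w) + size y + m).+1) = blank_cell.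
Proof.
rewrite tinit_cell nth_default; last by rewrite size_map size_cat; lia.
by have := size_input_prefix w; case: eqP => //; lia.
Qed.

Lemma tinit_guess w y m : m < size y ->
  rank (tcell (tm_tinit M (pair_enc w y)) (size (input_prefix w) + m).+1) = bit_cell (nth false y m).
Proof.
move=> hm; rewrite tinit_cell (nth_map false); last by rewrite size_cat; lia.
rewrite nth_cat ltnNge leq_addr /= addKn.
by have := size_input_prefix w; case: eqP => //; lia.
Qed.

Lemma sat_clauseE (val : tvar -> bool) (a b c : glit tvar) :
  (0 < gntrue val (a, b, c)) = [|| gtrue val a, gtrue val b | gtrue val c].
Proof. by rewrite /gntrue /=; do 3!case: (gtrue _ _). Qed.

Lemma gtrue_pos val v : gtrue val (pos v) = val v.
Proof. by rewrite /gtrue /=; case: (val v). Qed.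

Lemma gtrue_neg val v : gtrue val (neg v) = ~~ val v.
Proof. by rewrite /gtrue /=; case: (val v). Qed.

Lemma tableauP w T B N val :
  all (fun c => 0 < gntrue val c) (tableau w T B N) <->
  [/\ forall i, i < N -> let o := nth blank3 (first_row w B) i in
        [|| val (cell_var 0 i o.1.1), val (cell_var 0 i o.1.2) | val (cell_var 0 i o.2)],
      forall i, i < N -> val (cell_var 0 i blank_cell) -> val (cell_var 0 i.+1 blank_cell),
      forall t, t <= T -> val (cell_var t 0 border),
      forall t i a b c, t < T -> i < N ->
        (val (cell_var t i (rank a)) -> val (cell_var t i.+1 (rank b)) ->
         val (pair_var t i (rank a) (rank b))) /\
        (val (pair_var t i (rank a) (rank b)) -> val (cell_var t i.+2 (rank c)) ->
         val (cell_var t.+1 i.+1 (rank (rule a b c))))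
    & forall i s q, i < N -> q != tm_acc M -> ~~ val (cell_var T i (rank (Some (s, Some q))))].
Proof.
have hin n i : (i \in iota 0 n) = (i < n) by rewrite mem_iota.
rewrite /tableau !all_cat /init_clauses /blank_clauses /border_clauses !all_map.
rewrite /step_clauses /final_clauses !all_flatten_map; split.
  move=> /and5P[/allP h1 /allP h2 /allP h3 /allP h4 /allP h5]; split.
  - by move=> i hi; have := h1 i; rewrite hin /= sat_clauseE !gtrue_pos; apply.
  - move=> i hi hb; have := h2 i; rewrite hin /= sat_clauseE gtrue_neg gtrue_pos hb.
    by apply.
  - by move=> t ht; have := h3 t; rewrite hin /= sat_clauseE gtrue_pos !orbb; apply.
  - move=> t i a b c ht hi; have := h4 t; rewrite hin => /(_ ht).
    rewrite all_flatten_map => /allP /(_ i); rewrite hin => /(_ hi).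
    rewrite all_flatten_map /table all_map => /allP /(_ ((a, b), c)); rewrite mem_enum => /(_ isT).
    rewrite /= !sat_clauseE !gtrue_neg !gtrue_pos andbT => /andP[h6 h7]; split=> [ha hb|hu hc].
      by move: h6; rewrite ha hb.
    by move: h7; rewrite hu hc.
  - move=> i s q hi hq; have := h5 i; rewrite hin => /(_ hi).
    rewrite all_map /bad_cells all_map => /allP /(_ (Some (s, Some q))).
    by rewrite mem_filter mem_enum hq /= sat_clauseE gtrue_neg !orbb; apply.
case=> h1 h2 h3 h4 h5; apply/and5P; split; apply/allP.
- by move=> i; rewrite hin /= sat_clauseE !gtrue_pos; apply: h1.
- move=> i; rewrite hin /= sat_clauseE gtrue_neg gtrue_pos => hi.
  by case: (boolP (val _)) => //= hb; apply: h2.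
- by move=> t; rewrite hin /= sat_clauseE gtrue_pos !orbb; apply: h3.
- move=> t; rewrite hin => ht; rewrite all_flatten_map; apply/allP => i; rewrite hin => hi.
  rewrite all_flatten_map /table all_map; apply/allP => -[[a b] c] _ /=.
  have [h6 h7] := h4 t i a b c ht hi.
  rewrite !sat_clauseE !gtrue_neg !gtrue_pos andbT; apply/andP; split.
    case: (boolP (val (cell_var t i _))) => //= ha.
    by case: (boolP (val (cell_var t i.+1 _))) => //= hb; apply: h6.
  case: (boolP (val (pair_var _ _ _ _))) => //= ha.
  by case: (boolP (val (cell_var t i.+2 _))) => //= hb; apply: h7.
- move=> i; rewrite hin all_map /bad_cells all_map => hi; apply/allP => -[[s [q|]]|];
    rewrite mem_filter //= => /andP[hq _].
  by rewrite sat_clauseE gtrue_neg !orbb; apply: h5.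
Qed.

Lemma head_pos_run t c : (iter t (@tm_tstep M) c).1.2 <= c.1.2 + t.
Proof.
elim: t => [|t IH]; first by rewrite addn0.
rewrite iterS addnS; case: (iter t _ c) IH => [[q h] tp] /= IH.
rewrite /tm_tstep /tstep; case: ifP => _ /=; first by lia.
by case: (tm_delta q (tp h)) => [[q' b] []] /=; lia.
Qed.

(** The valuation may make several symbols true in one column; a witness is read off, and only its
    run is followed. At time [T] the head is in column at most [T.+1], and each step loses one
    column on the right, hence [2 * T]. The fixed blank after the guessed cells must also lie in the
    row. *)
Lemma tableau_sound w T B N :
  2 * T + size (input_prefix w) + B + 2 < N -> sat (tableau w T B N) -> accepting w T B.
Proof.
move=> hN [val /tableauP[hinit hblank hborder hstep hfinal]].
pose P := size (input_prefix w).
pose guess m := val (cell_var 0 (P + m).+1 blank_cell).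
pose n := find guess (iota 0 B).
have hn : n <= B by rewrite -[X in _ <= X](size_iota 0) find_size.
(* Before the first blank at least one bit symbol is true in each guessed column; if both are, true
   is preferred. *)
pose y := mkseq (fun m => val (cell_var 0 (P + m).+1 (bit_cell true))) n.
have hy : size y = n by rewrite size_mkseq.
pose c0 := tm_tinit M (pair_enc w y).
(* If no guessed column is blank, then [n = B] and the next column is a fixed blank. *)
have hstop : guess n.
  case: (ltnP n B) => [hlt|hge].
    have hh : has guess (iota 0 B) by rewrite has_find size_iota.
    by have := nth_find 0 hh; rewrite -/n nth_iota.
  have e : n = B by lia.
  have := hinit (P + B).+1; rewrite -[P + B]addn0 first_row_blank /= !orbb addn0.
  by rewrite /guess e; apply; rewrite /P; lia.
have hrow0 i : i < N -> val (cell_var 0 i (rank (tcell c0 i))).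
  case: i => [|j] hj; first by have := hinit 0 hj; rewrite /= !orbb.
  case: (ltnP j P) => hjP.
    by have := hinit _ hj; rewrite (first_row_prefix _ y) //= !orbb.
  rewrite -(subnKC hjP) in hj *; move: (j - P) hj => m hj {j hjP}.
  case: (ltnP m n) => hm.
    have hmy : m < size y by rewrite hy.
    rewrite /c0 tinit_guess // nth_mkseq //.
    have := hinit _ hj; rewrite first_row_guess /=; last by lia.
    have : guess m = false.
      by have := @before_find _ 0 guess (iota 0 B) m hm; rewrite nth_iota //; lia.
    rewrite /guess => ->; rewrite orbF.
    by case E: (val (cell_var 0 (P + m).+1 (bit_cell true))); rewrite ?E // orbF.
  rewrite -(subnKC hm) addnA -hy in hj *; rewrite /c0 tinit_blank; rewrite hy in hj *.
  elim: (m - n) hj => [|k IH] hj; first by rewrite addn0; apply: hstop.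
  by rewrite addnS; apply: hblank; [lia | apply: IH; lia].
(* [rule] looks at the right neighbour, so the controlled part of the row shrinks by one column per
   step. *)
have hrow t : t <= T -> forall i, i + t < N ->
    val (cell_var t i (rank (tcell (iter t (@tm_tstep M) c0) i))).
  elim: t => [|t IH] ht i hi; first by apply: hrow0; lia.
  case: i hi => [|i] hi; first exact: hborder.
  have {}IH := IH (ltnW ht); rewrite iterS tcell_step.
  set c := iter t _ c0 in IH *.
  have [h1 h2] := hstep t i (tcell c i) (tcell c i.+1) (tcell c i.+2) ht ltac:(lia).
  by apply: h2; [apply: h1|]; apply: IH; lia.
exists y; split; first by rewrite hy.
have hh := head_pos_run T c0; rewrite -/c0.
have := hrow T (leqnn T); case: (iter T _ c0) hh => [[q h] tp] /= hh hT.
apply/eqP; apply: contraT => hq.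
have := hT h.+1; rewrite /tcell /= eqxx => hv.
have := hfinal h.+1 (tp h) q _ hq; rewrite hv; last by lia.
by move=> /(_ ltac:(lia)).
Qed.

Lemma tableau_complete w T B N : accepting w T B -> sat (tableau w T B N).
Proof.
move=> [y [hy hacc]]; pose c t := iter t (@tm_tstep M) (tm_tinit M (pair_enc w y)).
pose val (v : tvar) :=
  let: ((t, i), (g, g')) := v in
  if g' is g2.+1 then (g == rank (tcell (c t) i)) && (g2 == rank (tcell (c t) i.+1))
  else g == rank (tcell (c t) i).
have hP := size_input_prefix w.
exists val; apply/tableauP; split.
- move=> i _; case: i => [|j]; first by rewrite /= eqxx.
  case: (ltnP j (size (input_prefix w))) => hj.
    by rewrite (first_row_prefix _ y) //= eqxx.
  rewrite -(subnKC hj); move: (j - _) => m {j hj}.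
  case: (ltnP m B) => hm; last first.
    rewrite -(subnKC hm) addnA first_row_blank /= orbb.
    rewrite (_ : _ + B + _ = size (input_prefix w) + size y + (B - size y + (m - B))); last by lia.
    by rewrite tinit_blank eqxx.
  rewrite first_row_guess //=; case: (ltnP m (size y)) => hmy.
    by rewrite tinit_guess //; case: (nth false y m); rewrite eqxx ?orbT.
  by rewrite -(subnKC hmy) addnA tinit_blank eqxx !orbT.
- move=> i _; case: i => [|j] /=; first by move=> /eqP /rank_inj.
  move=> /eqP hb; have {hb} := rank_inj hb.
  rewrite tinit_cell => -[hb _].
  (* The symbols of an input word are never blank. *)
  have hj : size (input_prefix w ++ y) <= j.
    rewrite leqNgt; apply/negP => hj; move: hb; rewrite (nth_map false) //.
    by move/(congr1 (@bit_of_sym M)); rewrite bit_of_symK.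
  rewrite size_cat in hj.
  by rewrite -(subnKC hj) -addnS tinit_blank.
- by move=> t _ /=.
- move=> t i a b d _ _; split=> /=; first by move=> -> ->.
  move=> /andP[/eqP/rank_inj -> /eqP/rank_inj ->] /eqP/rank_inj ->.
  by rewrite -tcell_step.
- move=> i s q _ hq /=; apply/eqP => /rank_inj; case: i => //= j; rewrite /tcell /=.
  by case: eqP => // _ [_ e]; move: hq; rewrite e /c hacc eqxx.
Qed.

End Tableau.

(** * The tableau is computable in polynomial time *)

Section LiteralPF.

Context {E : Type} {eE : encodable E}.

Lemma PF_cell_var (t i g : E -> nat) :
  PF t -> PF i -> PF g -> PF (fun e => cell_var (t e) (i e) (g e)).
Proof. by move=> ht hi hg; rewrite /cell_var; pf. Qed.

Lemma PF_pair_var (t i g1 g2 : E -> nat) :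
  PF t -> PF i -> PF g1 -> PF g2 -> PF (fun e => pair_var (t e) (i e) (g1 e) (g2 e)).
Proof. by move=> ht hi hg1 hg2; rewrite /pair_var; pf. Qed.

Lemma PF_pos (v : E -> tvar) : PF v -> PF (fun e => pos (v e)).
Proof. by move=> hv; rewrite /pos; pf. Qed.

Lemma PF_neg (v : E -> tvar) : PF v -> PF (fun e => neg (v e)).
Proof. by move=> hv; rewrite /neg; pf. Qed.

End LiteralPF.

Ltac pf_lit :=
  repeat first [ apply: PF_pos | apply: PF_neg | apply: PF_cell_var | apply: PF_pair_var ]; pf.

Section FirstRowPF.

Variable M : TM.
Context {E : Type} {eE : encodable E}.

Lemma PF_prefix (w : E -> seq bool) : PF w -> PF (fun e => input_prefix (w e)).
Proof.
move=> hw; rewrite /input_prefix; apply: PF_cat; last by pf.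
by apply: PF_flatten; apply: (@PF_map _ _ _ _ _ _ (fun _ b => [:: true; b])); pf.
Qed.

Lemma PF_first_row (w : E -> seq bool) (B : E -> nat) :
  PF w -> PF B -> PF (fun e => first_row M (w e) (B e)).
Proof.
move=> hw hB; rewrite /first_row.
(* A function on [bool] is a choice between two constants, however its values arise from [M]. *)
have hcell (f : bool -> nat) : PF f.
  by apply: (PF_eq (f := fun b : bool => if b then f true else f false)) => [[]|] //; pf.
have hh : PF (fun e => start_cell M (head false (input_prefix (w e)))).
  by apply: (PF_comp (hcell _)); apply: PF_head; apply: PF_prefix.
apply: PF_cons; first by pf.
apply: PF_cons; first by pf.
apply: PF_cat; last by apply: PF_nseq; pf.
apply: (@PF_map _ _ _ _ _ _ (fun _ b => (bit_cell M b, bit_cell M b, bit_cell M b))).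
  have hb : PF (fun p : E * bool => bit_cell M p.2) by apply: (PF_comp (hcell _)); pf.
  by pf.
by apply: PF_behead; apply: PF_prefix.
Qed.

End FirstRowPF.

Section TableauPF.

Variable M : TM.
Context {E : Type} {eE : encodable E}.

Lemma PF_tableau (w : E -> seq bool) (T B N : E -> nat) :
  PF w -> PF T -> PF B -> PF N -> PF (fun e => tableau M (w e) (T e) (B e) (N e)).
Proof.
move=> hw hT hB hN; rewrite /tableau.
have hiota (n : E -> nat) : PF n -> PF (fun e => iota 0 (n e)) by apply: PF_iota.
apply: PF_cat.
  apply: (@PF_map _ _ _ _ _ _ (fun e i => let o := nth (blank3 M) (first_row M (w e) (B e)) i in
    (pos (cell_var 0 i o.1.1), pos (cell_var 0 i o.1.2), pos (cell_var 0 i o.2)))); last exact: hiota.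
  have ho : PF (fun p : E * nat => nth (blank3 M) (first_row M (w p.1) (B p.1)) p.2).
    by apply: PF_nth; [apply: PF_first_row; [apply: (PF_comp hw)|apply: (PF_comp hB)]|]; pf.
  by apply: PF_pair; [apply: PF_pair|]; pf_lit.
apply: PF_cat.
  apply: (@PF_map _ _ _ _ _ _ (fun _ i => (neg (cell_var 0 i (blank_cell M)),
    neg (cell_var 0 i (blank_cell M)), pos (cell_var 0 i.+1 (blank_cell M))))); last exact: hiota.
  by apply: PF_pair; [apply: PF_pair|]; pf_lit.
apply: PF_cat.
  apply: (@PF_map _ _ _ _ _ _ (fun _ t => unit_clause (pos (cell_var t 0 (border M)))));
    last by apply: hiota; pf.
  by rewrite /unit_clause; apply: PF_pair; [apply: PF_pair|]; pf_lit.
apply: PF_cat.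
  apply: PF_flatten; apply: (@PF_map _ _ _ _ _ _ (fun e t => flatten
    [seq flatten [seq rule_clauses t i r | r <- table M] | i <- iota 0 (N e)])); last exact: hiota.
  apply: PF_flatten; apply: (@PF_map _ _ _ _ _ _ (fun (p : E * nat) i => flatten
    [seq rule_clauses p.2 i r | r <- table M])); last by apply: PF_iota; apply: (PF_comp hN); pf.
  apply: PF_flatten; apply: (@PF_map _ _ _ _ _ _ (fun (p : E * nat * nat) r =>
    rule_clauses p.1.2 p.2 r)); last by pf.
  rewrite /rule_clauses; apply: PF_cons; last apply: PF_cons; last exact: PF_cst.
    by apply: PF_pair; [apply: PF_pair|]; pf_lit.
  by apply: PF_pair; [apply: PF_pair|]; pf_lit.
apply: PF_flatten; apply: (@PF_map _ _ _ _ _ _ (fun e i =>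
  [seq unit_clause (neg (cell_var (T e) i g)) | g <- bad_cells M])); last exact: hiota.
apply: (@PF_map _ _ _ _ _ _ (fun (p : E * nat) g => unit_clause (neg (cell_var (T p.1) p.2 g))));
  last by pf.
have hT' : PF (fun p : E * nat * nat => T p.1.1) by apply: (PF_comp hT); pf.
by rewrite /unit_clause; apply: PF_pair; [apply: PF_pair|]; pf_lit.
Qed.

End TableauPF.

(** * The Cook-Levin reduction *)

Section CookLevin.

Variables (M : TM) (k l : nat).

Definition guess_len (w : seq bool) : nat := poly_bound l (size w).
Definition time_bound (w : seq bool) : nat := poly_bound k (2 * size w + 2 + guess_len w).
(** One more than the strict bound in [tableau_sound] excludes. *)
Definition width (w : seq bool) : nat := 2 * time_bound w + (2 * size w + 2) + guess_len w + 3.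

Definition reduction (w : seq bool) : seq bool :=
  ats_word _ (cell_var 0 0 0) (tableau M w (time_bound w) (guess_len w) (width w)).

Lemma PF_reduction : PF reduction.
Proof.
have hn : PF (fun w : seq bool => size w) by apply: PF_size; pf.
have hB : PF guess_len by apply: PF_poly_bound.
have h2 : PF (fun w : seq bool => 2 * size w + 2) by apply: PF_addn; [apply: PF_muln|]; pf.
have hT : PF time_bound by apply: PF_poly_bound; apply: PF_addn.
apply: PF_ats_word; apply: PF_tableau => //; first by pf.
apply: PF_addn; last by pf.
apply: PF_addn => //; apply: PF_addn => //; apply: PF_muln => //; exact: PF_cst.
Qed.

Lemma leq_poly_bound j m n : m <= n -> poly_bound j m <= poly_bound j n.
Proof.
move=> h; rewrite /poly_bound leq_add2r leq_mul2l; apply/orP; right.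
by case: j => // j; rewrite leq_exp2r.
Qed.

(** Runs on shorter witnesses may halt earlier, but final configurations are fixed points, so all of
    them can be inspected at the common time [time_bound w]. *)
Lemma accepting_run (V : language) w :
    (forall z, let c := @run M (poly_bound k (size z)) (@init M z) in
       halted c /\ ((c.1 == tm_acc M) <-> V z)) ->
  accepting M w (time_bound w) (guess_len w) <->
  exists y, size y <= guess_len w /\ V (pair_enc w y).
Proof.
move=> hV.
suff h y : size y <= guess_len w ->
    (iter (time_bound w) (@tm_tstep M) (tm_tinit M (pair_enc w y))).1.1 = tm_acc M
    <-> V (pair_enc w y).
  by split=> -[y [hy]] hacc; exists y; split=> //; apply/h.
move=> hy; set z := pair_enc w y; have [hh <-] := hV z.
have hle : poly_bound k (size z) <= time_bound w.
  by apply: leq_poly_bound; rewrite /z pair_encE size_cat size_input_prefix; lia.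
have := represents_run (poly_bound k (size z)) (represents_init M z).
move: hh; case: (run _ _) => q [[tl a] tr] hh.
case E: (iter _ _ _) => [[q' h] t] [/= hq _ _].
rewrite -(subnK hle) iterD E /tm_tstep iter_tstep_halted; last by rewrite /= hq.
by rewrite /= hq; split=> /eqP.
Qed.

End CookLevin.

Theorem ATS_NP_hard : NP_hard ATS_3CNF4.
Proof.
move=> L [V [[M [k hV]] [l hL]]].
exists (reduction M k l); split; first exact/PF_in_FP/PF_reduction.
move=> w; rewrite hL ATS_ats_word -(accepting_run l w hV); split.
  exact: tableau_complete.
by apply: tableau_sound; rewrite size_input_prefix /width; lia.
Qed.

Theorem theorem3 : NP_complete ATS_3CNF4.
Proof. exact: conj ATS_in_NP ATS_NP_hard. Qed.
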